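(* For any separable Banach space $X\neq\{0\}$, the associated Lindenstrauss space $Z$ satisfies $Sz(Z)=Sz(Z^* )=\omega$.
   Context: Scalars are real; $\mathbb{N}=\{1,2,\dots\}$; $\omega$ is the first infinite ordinal. Lindenstrauss space: let $(X,\|\cdot\|_X)$ be a separable Banach space, $X\ne\{0\}$, and fix a sequence $(x_i)_{i=1}^\infty$ dense in the unit sphere $S_X$. Let $$E=\Big\{a=(a_i)_{i=1}^\infty\in\mathbb{R}^{\mathbb{N}}:\ \|a\|_E=\sup_{0=p_0<p_1<\dots<p_k}\Big(\sum_{j=1}^k\Big\|\sum_{i=p_{j-1}+1}^{p_j}a_ix_i\Big\|_X^2\Big)^{1/2}<\infty\Big\},$$ the supremum being over all $k\in\mathbb{N}$ and all such finite increasing integer sequences. Then $(E,\|\cdot\|_E)$ is a Banach space, for each $a\in E$ the series $\sum_i a_ix_i$ converges in $X$, and $Q:E\to X$, $Q(a)=\sum_{i=1}^\infty a_ix_i$, is a bounded linear surjection. The Lindenstrauss space associated with $X$ (and the chosen sequence) is $Z=\ker Q$ with the norm $\|\cdot\|_E$. Szlenk index: for a Banach space $V$, a weak$^*$-compact $K\subset V^*$ and $\varepsilon>0$, put $s^1_\varepsilon(K)=\{v^*\in K:\ \operatorname{diam}(K\cap U)\ge\varepsilon\text{ for any weak}^*\text{-neighborhood }U\text{ of }v^*\}$ (norm diameter), $s^0_\varepsilon(K)=K$, $s^{\alpha+1}_\varepsilon(K)=s^1_\varepsilon(s^\alpha_\varepsilon(K))$, and $s^\alpha_\varepsilon(K)=\bigcap_{\beta<\alpha}s^\beta_\varepsilon(K)$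 for limit $\alpha$. Let $Sz(K,\varepsilon)=\inf\{\alpha: s^\alpha_\varepsilon(K)=\emptyset\}$ if it exists and $\infty$ otherwise; $Sz(K)=\sup_{\varepsilon>0}Sz(K,\varepsilon)$; $Sz(V)=Sz(B_{V^*})$, with $B_{V^*}$ the closed unit ball of $V^*$. *)

(* Defs.v *)
From HB Require Import structures.
From mathcomp Require Import all_boot all_order all_algebra.
From mathcomp Require Import all_classical all_reals all_analysis.
From mathcomp Require Import lra.

Set Implicit Arguments.
Unset Strict Implicit.
Unset Printing Implicit Defensive.

Import Order.TTheory GRing.Theory Num.Theory.
Import numFieldNormedType.Exports.

Local Open Scope classical_set_scope.
Local Open Scope ring_scope.

(* Representatives of ordinals: [Osup F] stands for the least upper bound of the
   family [F] (which is 0 if the family is empty).  Distinct terms may denote the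
   same ordinal: comparison is [ord_le], and equality of ordinals is [ord_eq]. *)
Inductive Ord : Type :=
| Ozero
| Osucc of Ord
| Osup (I : Type) of (I -> Ord).

Fixpoint ord_le (a : Ord) : Ord -> Prop :=
  match a with
  | Ozero => fun _ => True
  | Osup _ F => fun b => forall i, ord_le (F i) b
  | Osucc a' => fix ord_succ_le (b : Ord) : Prop :=
      match b with
      | Ozero => False
      | Osucc b' => ord_le a' b'
      | Osup _ G => exists j, ord_succ_le (G j)
      end
  end.

Definition ord_lt (a b : Ord) : Prop := ord_le (Osucc a) b.

Definition ord_eq (a b : Ord) : Prop := ord_le a b /\ ord_le b a.

Definition omega : Ord := Osup (fun n : nat => iter n Osucc Ozero).

Lemma ord_le_trans a b c : ord_le a b -> ord_le b c -> ord_le a c.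
Proof.
elim: a b c => [//|a IHa|I F IHF] b c; last by move=> Fb bc i; exact: IHF bc.
elim: b c => [//|b _|J G IHG] c; last by move=> [j aG] Gc; exact: (IHG j).
move=> /= ab; elim: c => [//|c _ bc|K H IHH [k bH]]; first exact: IHa bc.
by exists k; exact: IHH.
Qed.

Lemma ord_le_sup I (F : I -> Ord) i a : ord_le a (F i) -> ord_le a (Osup F).
Proof. by elim: a => [//|a _ aF|J G IHG GF j]; [exists i|exact: IHG]. Qed.

Lemma ord_le_refl a : ord_le a a.
Proof. by elim: a => [//|//|I F IHF i]; exact: ord_le_sup (IHF i). Qed.

Lemma ord_le_succ a : ord_le a (Osucc a).
Proof.
elim: a => [//|//|I F IHF i]; apply: ord_le_trans (IHF i) _ => /=.
exact/ord_le_sup/ord_le_refl.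
Qed.

Lemma ord_ltW a b : ord_lt a b -> ord_le a b.
Proof. exact/ord_le_trans/ord_le_succ. Qed.

Lemma ord_le_total a b : ord_le a b \/ ord_lt b a.
Proof.
elim: a b => [|a IHa|I F IHF] b; first by left.
- elim: b => [|b _|J G IHG]; [by right|exact: IHa|].
  have [[j aG]|nG] := pselect (exists j, ord_le (Osucc a) (G j)).
    by left; exists j.
  right => j; have [aG|//] := IHG j; by case: nG; exists j.
- have [[i bF]|nF] := pselect (exists i, ord_lt b (F i)); first by right; exists i.
  by left => i; have [//|bF] := IHF i b; case: nF; exists i.
Qed.

Lemma ord_lt_wf : well_founded ord_lt.
Proof.
suff H a b : ord_le b a -> Acc ord_lt b by move=> a; exact/H/ord_le_refl.
elim: a b => [|a IHa|I F IHF] b ba; constructor => c cb.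
- by have := ord_le_trans cb ba.
- exact/IHa/(ord_le_trans cb ba).
- by have [i cF] := ord_le_trans cb ba; exact/(IHF i)/ord_ltW.
Qed.

Lemma ord_lt_irr a : ~ ord_lt a a.
Proof. by elim/(well_founded_ind ord_lt_wf): a => a IHa aa; exact: (IHa a aa). Qed.

Lemma ord_le_min (A : Ord -> Prop) : (exists a, A a) ->
  exists2 a, A a & forall b, A b -> ord_le a b.
Proof.
move=> [a]; elim/(well_founded_ind ord_lt_wf): a => a IHa Aa.
have [[b Ab ba]|nb] := pselect (exists2 b, A b & ord_lt b a); first exact: IHa ba Ab.
exists a => // b Ab; have [//|ba] := ord_le_total a b.
by case: nb; exists b.
Qed.

(* Ordinals extended with a top element [None], standing for infinity. *)
Definition eord_eq (a b : option Ord) : Prop :=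
  match a, b with
  | Some a', Some b' => ord_eq a' b'
  | None, None => True
  | _, _ => False
  end.

(* [s2val] extracts the least element; it is unique up to [ord_eq]. *)
Definition ord_inf (A : Ord -> Prop) : option Ord :=
  if pselect (exists a, A a) is left A0 then Some (s2val (cid2 (ord_le_min A0)))
  else None.

Definition eord_sup (I : Type) (F : I -> option Ord) : option Ord :=
  if pselect (exists i, F i = None) then None
  else Some (Osup (fun i => odflt Ozero (F i))).

(* Completeness of a normed space [T] whose elements are determined by scalar
   evaluations [ev]; [le_sn h r] says that the family [h] of values has norm at most r. *)
Section complete_of_evaluations.
Variables (R : realType) (T : normedModType R) (I : Type) (ev : T -> I -> R).
Variables (c : I -> R) (le_sn : (I -> R) -> R -> Prop).
Hypothesis evB : forall s t i, ev (s - t) i = ev s i - ev t i.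
Hypothesis ev_le : forall t i, `|ev t i| <= c i * `|t|.
Hypothesis le_snP : forall t r, 0 < r -> le_sn (ev t) r <-> `|t| <= r.
Hypothesis le_sn_lim : forall (F : set_system T) (f : T -> I -> R) l r,
  ProperFilter F -> (forall i, f ^~ i @ F --> l i) ->
  (\forall t \near F, le_sn (f t) r) -> le_sn l r.
Hypothesis ev_closed : forall (F : set_system T) l,
  ProperFilter F -> (forall i, ev ^~ i @ F --> l i) ->
  (forall e, 0 < e -> exists t, le_sn (fun i => l i - ev t i) e) ->
  exists t, ev t = l.

Lemma complete_of_evaluations (F : set_system T) :
  ProperFilter F -> cauchy F -> cvg F.
Proof.
move=> FF /cauchyP Fc.
have {}Fc e : 0 < e -> exists t, \forall s \near F, `|t - s| < e.
  move=> e0; have [t Ft] := Fc e e0.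
  by exists t; move: Ft; rewrite -ball_normE.
have lP i : cvg (ev ^~ i @ F).
  apply/cauchy_cvgP/cauchy_exP => e e0.
  have d0 : 0 < e / (`|c i| + 1) by rewrite divr_gt0// ltr_wpDl.
  have [t tF] := Fc _ d0; exists (ev t i).
  move: tF; apply: filterS => s ts /=; rewrite -ball_normE/= -evB.
  rewrite (le_lt_trans (ev_le _ _))//.
  rewrite (@le_lt_trans _ _ ((`|c i| + 1) * `|t - s|))//.
    by rewrite ler_wpM2r// (le_trans (ler_norm _))// lerDl.
  by rewrite mulrC -ltr_pdivlMr// ltr_wpDl.
pose l i := lim (ev ^~ i @ F).
have el i : ev ^~ i @ F --> l i by exact: lP.
have ll t e : 0 < e -> (\forall s \near F, `|t - s| < e) ->
    le_sn (fun i => l i - ev t i) e.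
  move=> e0 tF; apply: (@le_sn_lim F (fun s i => ev (s - t) i) _ _ FF) => [i|].
    have -> : (fun s => ev (s - t) i) = fun s => ev s i - ev t i by exact/funext.
    by apply: cvgB; [exact: el|exact: cvg_cst].
  move: tF; apply: filterS => s ts; apply/le_snP => //.
  by rewrite distrC ltW.
have [t tl] : exists t, ev t = l.
  apply: (@ev_closed F l FF el) => e e0; have [t tF] := Fc _ e0.
  by exists t; exact: ll.
apply/cvg_ex; exists t; apply/cvgrPdist_le => e e0.
have e20 : 0 < e / 2 by rewrite divr_gt0.
have [s sF] := Fc _ e20.
have ts : `|t - s| <= e / 2.
  apply/le_snP => //; rewrite (_ : ev _ = fun i => l i - ev s i); first exact: ll.
  by apply/funext => i; rewrite evB tl.
move: sF; apply: filterS => u su.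
rewrite (le_trans (ler_distD s _ _))// [leRHS]splitr lerD// ltW//.
Qed.
End complete_of_evaluations.

Section dual.
Variables (R : realType) (V : normedModType R).

Definition dual_pred : {pred V -> R^o} := fun f => `[< linear f /\ continuous f >].

Lemma dual_submod : submod_closed dual_pred.
Proof.
split.
  apply/asboolP; split; first by move=> a x y; rewrite /= scaler0 addr0.
  exact: cst_continuous.
move=> a f g /asboolP[lf cf] /asboolP[lg cg]; apply/asboolP; split.
  move=> b x y; rewrite !fctE lf lg !scalerDr !scalerA mulrC -!addrA; congr (_ + _).
  by rewrite addrCA.
by move=> x; apply: cvgD; [apply: cvgZr; exact: cf|exact: cg].
Qed.

HB.instance Definition _ :=
  GRing.isSubmodClosed.Build R (V -> R^o) dual_pred dual_submod.

Record dual : Type := Dual {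
  dual_fun :> V -> R^o ;
  dual_funP : dual_fun \in dual_pred }.

HB.instance Definition _ := [isSub for dual_fun].
HB.instance Definition _ := [Choice of dual by <:].
HB.instance Definition _ := [SubChoice_isSubLmodule of dual by <:].

Implicit Types (f g : dual) (v : V).

HB.instance Definition _ f := GRing.isLinear.Build R V R^o *:%R (dual_fun f)
  (asboolP _ (dual_funP f)).1.

Lemma dual_continuous f : continuous f.
Proof. exact: (asboolP _ (dual_funP f)).2. Qed.

Definition dual_norm (f : dual) : R :=
  sup [set `|f v| | v in [set v : V | `|v| <= 1]].

Let dual_norm_has_sup f : has_sup [set `|f v| | v in [set v : V | `|v| <= 1]].
Proof.
split; first by exists `|f 0|, 0; rewrite //= normr0.
have /linear_bounded_continuous/bounded_funP/(_ 1)[M fM] := @dual_continuous f.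
by exists M => _ [v /= v1 <-]; exact: fM.
Qed.

Let dual_norm_le f v : `|v| <= 1 -> `|f v| <= dual_norm f.
Proof. by move=> v1; apply: ub_le_sup; [case: (dual_norm_has_sup f)|exists v]. Qed.

Let dual_norm_ge0 f : 0 <= dual_norm f.
Proof. by rewrite (le_trans _ (dual_norm_le f (v := 0) _)) ?normr0 ?ler01. Qed.

Let dual_ler_norm f v : `|f v| <= dual_norm f * `|v|.
Proof.
have [->|v0] := eqVneq v 0; first by rewrite linear0 !normr0 mulr0.
have v1 : `| `|v|^-1 *: v| <= 1 by rewrite normrZ normfV normr_id mulVf ?normr_eq0.
have := dual_norm_le f v1; rewrite linearZ/= normrM normfV normr_id.
by rewrite ler_pdivrMl ?normr_gt0// mulrC.
Qed.

Let dual_norm_leP f r : 0 <= r ->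
  (forall v, `|f v| <= r * `|v|) <-> dual_norm f <= r.
Proof.
move=> r0; split=> [fr|fr v]; last first.
  by rewrite (le_trans (dual_ler_norm _ _))// ler_wpM2r.
apply: ge_sup; first by case: (dual_norm_has_sup f).
by move=> _ [v /= v1 <-]; rewrite (le_trans (fr v))// ler_piMr.
Qed.

Let dual_normD f g : dual_norm (f + g) <= dual_norm f + dual_norm g.
Proof.
apply/dual_norm_leP => [|v]; first exact: addr_ge0.
by rewrite mulrDl (le_trans (ler_normD _ _))// lerD.
Qed.

Let dual_normZ (a : R) f : dual_norm (a *: f) = `|a| * dual_norm f.
Proof.
have H (b : R) (g : dual) : dual_norm (b *: g) <= `|b| * dual_norm g.
  apply/dual_norm_leP => [|v]; first exact: mulr_ge0.
  by rewrite normrZ -mulrA ler_wpM2l.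
apply/eqP; rewrite eq_le H/=; have [->|a0] := eqVneq a 0.
  by rewrite normr0 mul0r.
have := H a^-1 (a *: f); rewrite scalerA mulVf// scale1r normfV.
by rewrite ler_pdivlMl// normr_gt0.
Qed.

Let dual_norm_eq0 f : dual_norm f = 0 -> f = 0.
Proof.
move=> f0; apply/val_inj/funext => v /=; apply/normr0_eq0/eqP.
by rewrite eq_le normr_ge0 andbT -(mul0r `|v|) -f0.
Qed.

HB.instance Definition _ :=
  Lmodule_isNormed.Build R dual dual_normD dual_normZ dual_norm_eq0.

Lemma dual_normE f : `|f| = sup [set `|f v| | v in [set v : V | `|v| <= 1]].
Proof. by []. Qed.

Lemma ler_dual_norm f v : `|f v| <= `|f| * `|v|. Proof. exact: dual_ler_norm. Qed.

Lemma ler_dualP f r : 0 <= r -> (forall v, `|f v| <= r * `|v|) <-> `|f| <= r.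
Proof. exact: dual_norm_leP. Qed.

Let dual_complete (F : set_system dual) : ProperFilter F -> cauchy F -> cvg F.
Proof.
apply: (complete_of_evaluations (ev := fun f v => f v : R) (c := fun v => `|v|)
  (le_sn := fun h r => forall v, `|h v| <= r * `|v|)) => //.
- by move=> f v; rewrite mulrC; exact: ler_dual_norm.
- by move=> f r r0; apply/ler_dualP/ltW.
- move=> G h l r GG hl hr v; apply: (cvgr_to_le (cvg_norm (hl v))).
  by move: hr; apply: filterS.
- move=> G l GG Gl lc.
  have lP : (l : V -> R^o) \in dual_pred.
    have ll : linear (l : V -> R^o).
      move=> a x y; apply: (cvg_unique _ (Gl (a *: x + y))) => //.
      rewrite (_ : (fun _ => _) = fun f : dual => a *: f x + f y); last first.
        by apply/funext => f; rewrite linearP.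
      by apply: cvgD => //; apply: cvgZr.
    apply/asboolP; split => //.
    have [t tl] := lc 1 ltr01.
    pose m := GRing.isLinear.Build R V R^o *:%R _ ll.
    pose L : {linear V -> R^o} := HB.pack (l : V -> R^o) m.
    apply: (linear_bounded_continuous L).1; apply/bounded_funP => r.
    exists ((1 + `|t|) * `|r|) => v vr.
    rewrite -[L v](subrK (t v)) (le_trans (ler_normD _ _))// mulrDl lerD//.
      by rewrite (le_trans (tl v))// ler_pM2l ?(le_trans vr (ler_norm _)).
    by rewrite (le_trans (ler_dual_norm t v))// ler_wpM2l ?(le_trans vr (ler_norm _)).
  by exists (Dual lP).
Qed.

HB.instance Definition _ := Uniform_isComplete.Build dual dual_complete.

End dual.

Section szlenk.
Variables (R : realType) (V : completeNormedModType R).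
Implicit Types (A K U : set (dual V)) (e : R) (a b : Ord).

(* The dual with the topology of pointwise convergence, instead of its norm topology. *)
Definition weak_star : Type :=
  initial_topology (fun f : dual V => (f : V -> R) : {ptws V -> R}).

HB.instance Definition _ := Topological.on weak_star.

Definition diam A : \bar R := ereal_sup [set (`|f - g|)%:E | f in A & g in A].

Definition szlenk1 e K : set (dual V) :=
  [set f | K f /\
    forall U, nbhs (f : weak_star) (U : set weak_star) -> (e%:E <= diam (K `&` U))%E].

(* The [Osup] clause covers limit ordinals, see [szlenk_derived_limit]; the
   intersection with [K] only matters for the empty supremum, that is, 0. *)
Fixpoint szlenk_derived e K a : set (dual V) :=
  match a with
  | Ozero => K
  | Osucc b => szlenk1 e (szlenk_derived e K b)
  | Osup _ F => K `&` \bigcap_i szlenk_derived e K (F i)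
  end.

Lemma szlenk1_sub e K : szlenk1 e K `<=` K.
Proof. by move=> f []. Qed.

Lemma szlenk1S e A K : A `<=` K -> szlenk1 e A `<=` szlenk1 e K.
Proof.
move=> AK f [Af fU]; split=> [|U /fU eU]; first exact: AK.
rewrite (le_trans eU)//; apply: ge_ereal_sup => _ [g [Ag Ug] [h [Ah Uh] <-]].
apply: ereal_sup_ubound; exists g; first by split => //; exact: AK.
by exists h => //; split => //; exact: AK.
Qed.

Lemma szlenk_derived_sub e K a : szlenk_derived e K a `<=` K.
Proof.
elim: a => [//|a IHa|I F _]; last by move=> f [].
exact: subset_trans (@szlenk1_sub _ _) IHa.
Qed.

Lemma szlenk_derived_anti e K a b :
  ord_le a b -> szlenk_derived e K b `<=` szlenk_derived e K a.
Proof.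
elim: a b => [|a IHa|I F IHF] b; first by move=> _; exact: szlenk_derived_sub.
- elim: b => [//|b _ ab|J G IHG [j aG]]; first exact/szlenk1S/IHa.
  by move=> f [_ /(_ j I)]; exact: IHG.
- move=> Fb f fb; split; first exact: szlenk_derived_sub fb.
  by move=> i _; exact: IHF fb.
Qed.

Lemma szlenk_derived_eq e K a b :
  ord_eq a b -> szlenk_derived e K a = szlenk_derived e K b.
Proof. by move=> [ab ba]; apply/seteqP; split; exact: szlenk_derived_anti. Qed.

Lemma szlenk_derived_limit e K a :
  (exists b, ord_lt b a) -> (forall b, ord_lt b a -> ord_lt (Osucc b) a) ->
  szlenk_derived e K a = [set f | forall b, ord_lt b a -> szlenk_derived e K b f].
Proof.
move=> a0 aS; apply/seteqP; split.
  by move=> f fa b ba; exact: szlenk_derived_anti (ord_ltW ba) _ fa.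
move=> f fb; have fK : K f by have [b /fb] := a0; exact: szlenk_derived_sub.
elim: a a0 aS fb => [//|a _ _ /(_ a (ord_le_refl _))/ord_lt_irr//|J F IHF a0 aS fb].
split => // i _; have [aF|Fa] := ord_le_total (Osup F) (F i); last exact: fb.
have Fa : ord_le (F i) (Osup F) by exact/ord_le_sup/ord_le_refl.
have ltP b : ord_lt b (Osup F) <-> ord_lt b (F i).
  by split=> h; exact: ord_le_trans h _.
apply: IHF.
- by have [b /ltP ba] := a0; exists b.
- by move=> b /ltP/aS/ltP.
- by move=> b /ltP; exact: fb.
Qed.

Definition szlenk_eps K e : option Ord :=
  ord_inf (fun a => szlenk_derived e K a = set0).

Definition szlenk_set K : option Ord :=
  eord_sup (fun e : {posnum R} => szlenk_eps K e%:num).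

Definition szlenk : option Ord := szlenk_set [set f | `|f| <= 1].

End szlenk.
Arguments szlenk {R} V.

Definition separable (T : topologicalType) : Prop :=
  exists A : set T, countable A /\ dense A.

Record dense_sphere_seq (R : realType) (X : normedModType R) := DenseSphereSeq {
  sphere_seq :> nat -> X ;
  sphere_seq_norm : forall i, `|sphere_seq i| = 1 ;
  sphere_seq_dense : [set v : X | `|v| = 1] `<=` closure (range sphere_seq) }.

Section lindenstrauss.
Variables (R : realType) (X : completeNormedModType R) (x : dense_sphere_seq X).
Implicit Types (a b : nat -> R) (k n : nat) (p : nat -> nat).

(* Sequences are indexed from 0, so [a i] and [x i] are the terms of rank i + 1, and
   the block of ranks p_{j-1} + 1, ..., p_j is the index range p_{j-1} <= i < p_j. *)
Definition cut_points k p : Prop :=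
  [/\ (0 < k)%N, p 0%N = 0%N & forall j, (j < k)%N -> (p j < p j.+1)%N].

Definition block_norm a k p : R :=
  Num.sqrt (\sum_(j < k) `|\sum_(p j <= i < p j.+1) a i *: x i| ^+ 2).

Definition lind_normE a : \bar R :=
  ereal_sup [set (block_norm a kp.1 kp.2)%:E | kp in [set kp | cut_points kp.1 kp.2]].

Definition lind_E : set (nat -> R) := [set a | (lind_normE a < +oo)%E].

Definition lind_Q a : X := limn (series (fun i => a i *: x i)).

Let sqrtD2 (A B u v : R) : 0 <= A -> 0 <= B ->  0 <= u -> 0 <= v ->
  Num.sqrt ((A + B) ^+ 2 + (u + v) ^+ 2) <=
  Num.sqrt (A ^+ 2 + u ^+ 2) + Num.sqrt (B ^+ 2 + v ^+ 2).
Proof.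
move=> A0 B0 u0 v0; set s := Num.sqrt (A ^+ 2 + _); set t := Num.sqrt (B ^+ 2 + _).
have s0 : 0 <= s by exact: sqrtr_ge0.
have t0 : 0 <= t by exact: sqrtr_ge0.
have s2 : s ^+ 2 = A ^+ 2 + u ^+ 2 by rewrite sqr_sqrtr// addr_ge0 ?sqr_ge0.
have t2 : t ^+ 2 = B ^+ 2 + v ^+ 2 by rewrite sqr_sqrtr// addr_ge0 ?sqr_ge0.
rewrite -(ler_pXn2r (n := 2))// ?nnegrE ?sqrtr_ge0 ?addr_ge0//.
rewrite sqr_sqrtr ?addr_ge0 ?sqr_ge0//.
have st : A * B + u * v <= s * t.
  rewrite -(ler_pXn2r (n := 2))// ?nnegrE ?addr_ge0 ?mulr_ge0// exprMn s2 t2.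
  have := sqr_ge0 (A * v - u * B); nra.
by nra.
Qed.

Let minkowski2 k (u v w : nat -> R) :
  (forall j, 0 <= u j) -> (forall j, 0 <= v j) ->
  (forall j, 0 <= w j <= u j + v j) ->
  Num.sqrt (\sum_(j < k) w j ^+ 2) <=
  Num.sqrt (\sum_(j < k) u j ^+ 2) + Num.sqrt (\sum_(j < k) v j ^+ 2).
Proof.
move=> u0 v0 wuv; elim: k => [|k IHk]; first by rewrite !big_ord0 sqrtr0 addr0.
rewrite !big_ord_recr/=.
set W := \sum_(i < k) w i ^+ 2 in IHk *; set U := \sum_(i < k) u i ^+ 2 in IHk *.
set V := \sum_(i < k) v i ^+ 2 in IHk *.
have W0 : 0 <= W by apply: sumr_ge0 => j _; exact: sqr_ge0.
have U0 : 0 <= U by apply: sumr_ge0 => j _; exact: sqr_ge0.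
have V0 : 0 <= V by apply: sumr_ge0 => j _; exact: sqr_ge0.
have := sqrtD2 (sqrtr_ge0 U) (sqrtr_ge0 V) (u0 k) (v0 k).
rewrite (sqr_sqrtr U0) (sqr_sqrtr V0); apply: le_trans.
have /andP[w0 wk] := wuv k.
rewrite ler_sqrt ?addr_ge0 ?sqr_ge0//; apply: lerD.
  rewrite -[leLHS](sqr_sqrtr W0).
  by rewrite ler_pXn2r// ?nnegrE ?addr_ge0 ?sqrtr_ge0.
by rewrite ler_pXn2r// ?nnegrE// addr_ge0.
Qed.

Let block_normD a b k p : block_norm (a + b) k p <= block_norm a k p + block_norm b k p.
Proof.
rewrite /block_norm.
apply: (minkowski2 k (u := fun j => `|\sum_(p j <= i < p j.+1) a i *: x i|)
  (v := fun j => `|\sum_(p j <= i < p j.+1) b i *: x i|)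
  (w := fun j => `|\sum_(p j <= i < p j.+1) (a + b) i *: x i|)) => // j.
rewrite normr_ge0/= (le_trans _ (ler_normD _ _))// -big_split/=.
by under eq_bigr do rewrite scalerDl.
Qed.

Let block_normZ (c : R) a k p : block_norm (c *: a) k p = `|c| * block_norm a k p.
Proof.
rewrite /block_norm -(sqrtr_sqr c) -sqrtrM ?sqr_ge0// mulr_sumr; congr Num.sqrt.
apply: eq_bigr => j _; rewrite -[c ^+ 2]real_normK ?num_real// -exprMn -normrZ.
by rewrite scaler_sumr; under eq_bigr do rewrite -scalerA.
Qed.

Let le_sn a (r : R) := forall k p, cut_points k p -> block_norm a k p <= r.

Let lind_normE_leP a r : (lind_normE a <= r%:E)%E <-> le_sn a r.
Proof.
split=> [ar k p kp|ar]; last first.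
  by apply: ub_ereal_sup => _ [[k p] /= kp <-]; rewrite lee_fin; exact: ar.
rewrite -lee_fin (le_trans _ ar)//; apply: ereal_sup_ubound.
by exists (k, p).
Qed.

Let lind_normE_ge0 a : (0 <= lind_normE a)%E.
Proof.
apply: (@le_trans _ _ (block_norm a 1 id)%:E).
  by rewrite lee_fin sqrtr_ge0.
by apply: ereal_sup_ubound; exists (1%N, id).
Qed.

Let lind_EP a : lind_E a -> lind_normE a = (fine (lind_normE a))%:E.
Proof. by move=> aE; rewrite fineK// ge0_fin_numE. Qed.

Let lind_E_le_sn a r : le_sn a r -> lind_E a.
Proof. by move=> /lind_normE_leP ar; rewrite /lind_E/= (le_lt_trans ar)// ltry. Qed.

Let lind_E_sn a : lind_E a -> le_sn a (fine (lind_normE a)).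
Proof. by move=> /lind_EP aE; apply/lind_normE_leP; rewrite -aE. Qed.

Lemma lind_cvg a : lind_E a -> cvgn (series (fun i => a i *: x i)).
Proof.
move=> /lind_E_sn; set M := fine _ => aM.
apply/cauchy_cvgP/cauchy_seriesP => e e0; apply: contrapT => nc.
have {nc}far N : exists m n,
    [/\ (N <= m)%N, (m < n)%N & e <= `|\sum_(m <= i < n) a i *: x i|].
  apply: contrapT => near_N; apply: nc.
  exists ([set m | (N <= m)%N], [set n | (N <= n)%N]).
    by split; exists N.
  move=> [m n] /= [Nm Nn]; rewrite ltNge; apply/negP => emn.
  have [nm|mn] := leqP n m; last by apply: near_N; exists m, n.
  by move: emn; rewrite big_geq// normr0 leNgt e0.
have build K : exists k p, cut_points k p /\
    K%:R * e ^+ 2 <= \sum_(j < k) `|\sum_(p j <= i < p j.+1) a i *: x i| ^+ 2.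
  elim: K => [|K [k [p [[k0 p0 pk] IHK]]]].
    exists 1%N, id; split => //; rewrite mul0r; apply: sumr_ge0 => j _.
    exact: sqr_ge0.
  have [m [n [km mn emn]]] := far (p k).+1.
  pose q j := if (j <= k)%N then p j else if j == k.+1 then m else n.
  have qk j : (j <= k)%N -> q j = p j by rewrite /q => ->.
  have qk1 : q k.+1 = m by rewrite /q ltnn eqxx.
  have qk2 : q k.+2 = n by rewrite /q leqNgt ltnS leqnSn/= gtn_eqF.
  exists k.+2, q; split.
    split; [by []|by rewrite qk|move=> j].
    rewrite ltnS leq_eqVlt => /predU1P[->|]; first by rewrite qk1 qk2.
    rewrite ltnS leq_eqVlt => /predU1P[->|jk]; first by rewrite qk// qk1.
    by rewrite !qk ?pk// ltnW.
  rewrite !big_ord_recr/= -natr1 mulrDl mul1r; apply: lerD.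
    rewrite (le_trans IHK)// -[leLHS]addr0 lerD ?sqr_ge0//.
    rewrite le_eqVlt; apply/orP; left; apply/eqP; apply: eq_bigr => -[j jk] _ /=.
    by rewrite !qk// ltnW.
  by rewrite qk1 qk2 ler_pXn2r// nnegrE ?normr_ge0 ?(ltW e0).
have M0 : 0 <= M by rewrite fine_ge0.
pose N := Num.bound (M ^+ 2 / e ^+ 2).
have [k [p [kp]]] := build N; apply/negP; rewrite -ltNge.
have : block_norm a k p ^+ 2 <= M ^+ 2.
  by rewrite ler_pXn2r// ?nnegrE ?sqrtr_ge0// aM.
rewrite sqr_sqrtr; last by apply: sumr_ge0 => j _; exact: sqr_ge0.
move=> /le_lt_trans; apply; rewrite -ltr_pdivrMr ?exprn_gt0//.
by apply: archi_boundP; rewrite divr_ge0 ?sqr_ge0.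
Qed.

Definition lind_pred : {pred nat -> R} := fun a => `[< lind_E a /\ lind_Q a = 0 >].

Lemma lind_submod : submod_closed lind_pred.
Proof.
have le0 r : 0 <= r -> le_sn 0 r.
  move=> r0 k p _; rewrite -(scale0r (0 : nat -> R)) block_normZ normr0 mul0r//.
split.
  apply/asboolP; split; first exact: lind_E_le_sn (le0 0 _).
  apply/cvg_lim => //; rewrite (_ : series _ = cst 0); first exact: cvg_cst.
  by apply/funext => n; rewrite /series/= big1// => i _; rewrite scale0r.
move=> c a b /asboolP[aE aQ] /asboolP[bE bQ]; apply/asboolP; split.
  apply: (@lind_E_le_sn _ (`|c| * fine (lind_normE a) + fine (lind_normE b))).
  move=> k p kp; rewrite (le_trans (block_normD _ _ _ _))// block_normZ.
  by rewrite lerD ?ler_wpM2l ?lind_E_sn.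
apply/cvg_lim => //.
rewrite (_ : series _ = fun n => c *: series (fun i => a i *: x i) n +
    series (fun i => b i *: x i) n); last first.
  apply/funext => n; rewrite /series/= scaler_sumr -big_split/=.
  by apply: eq_bigr => i _; rewrite scalerDl scalerA.
rewrite -(addr0 0) -{1}(scaler0 _ c) -{1}aQ -bQ.
by apply: cvgD; [apply: cvgZr|]; exact: lind_cvg.
Qed.

HB.instance Definition _ :=
  GRing.isSubmodClosed.Build R (nat -> R) lind_pred lind_submod.

Record lindenstrauss : Type := Lindenstrauss {
  lind_fun :> nat -> R ;
  lind_funP : lind_fun \in lind_pred }.

HB.instance Definition _ := [isSub for lind_fun].
HB.instance Definition _ := [Choice of lindenstrauss by <:].
HB.instance Definition _ := [SubChoice_isSubLmodule of lindenstrauss by <:].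

Implicit Types z w : lindenstrauss.

Lemma lind_inE z : lind_E z. Proof. exact: (asboolP _ (lind_funP z)).1. Qed.

Lemma lind_Q0 z : lind_Q z = 0. Proof. exact: (asboolP _ (lind_funP z)).2. Qed.

Definition lind_norm z : R := fine (lind_normE z).

Let lind_normP z r : le_sn z r <-> lind_norm z <= r.
Proof.
apply: (iff_trans (iff_sym (lind_normE_leP _ _))).
by rewrite (lind_EP (lind_inE z)) lee_fin.
Qed.

Let lind_norm_ge0 z : 0 <= lind_norm z. Proof. by rewrite fine_ge0. Qed.

Let lind_block z k p : cut_points k p -> block_norm z k p <= lind_norm z.
Proof. by move=> kp; apply: (lind_normP _ _).2 kp. Qed.

Let lind_normD z w : lind_norm (z + w) <= lind_norm z + lind_norm w.
Proof.
apply/lind_normP => k p kp; apply: (le_trans (block_normD _ _ _ _)).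
by rewrite lerD ?lind_block.
Qed.

Let lind_normZ (c : R) z : lind_norm (c *: z) = `|c| * lind_norm z.
Proof.
have H (d : R) (w : lindenstrauss) : lind_norm (d *: w) <= `|d| * lind_norm w.
  apply/lind_normP => k p kp; rewrite [leLHS](block_normZ d w k p).
  by rewrite ler_wpM2l ?lind_block.
apply/eqP; rewrite eq_le H/=; have [->|c0] := eqVneq c 0.
  by rewrite normr0 mul0r.
have := H c^-1 (c *: z); rewrite scalerA mulVf// scale1r normfV.
by rewrite ler_pdivlMl// normr_gt0.
Qed.

Let le_coord a i r : le_sn a r -> `|a i| <= r.
Proof.
move=> ar; have r0 : 0 <= r by exact: le_trans (sqrtr_ge0 _) (ar 1%N id _).
apply: le_trans (ar i.+1 id _) => //; rewrite /block_norm -[leLHS]sqrtr_sqr.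
rewrite ler_sqrt; last by apply: sumr_ge0 => j _; exact: sqr_ge0.
rewrite big_ord_recr/= big_nat1 normrZ sphere_seq_norm mulr1 real_normK ?num_real// lerDr.
by apply: sumr_ge0 => j _; exact: sqr_ge0.
Qed.

Let lind_norm_eq0 z : lind_norm z = 0 -> z = 0.
Proof.
move=> z0; apply/val_inj/funext => i /=; apply/normr0_eq0/eqP.
by rewrite eq_le normr_ge0 andbT; apply/le_coord/lind_normP; rewrite z0.
Qed.

HB.instance Definition _ :=
  Lmodule_isNormed.Build R lindenstrauss lind_normD lind_normZ lind_norm_eq0.

Lemma lind_normE_val z : `|z|%:E = lind_normE z.
Proof. by rewrite [RHS](lind_EP (lind_inE z)). Qed.

Let cvg_block_norm (F : set_system lindenstrauss) (f : lindenstrauss -> nat -> R) l k p :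
  ProperFilter F -> (forall i, f ^~ i @ F --> l i) ->
  (fun z => block_norm (f z) k p) @ F --> block_norm l k p.
Proof.
move=> FF fl; apply: continuous_cvg; first exact: sqrt_continuous.
apply: (cvg_big (op := +%R) (@add_continuous _)) => j _.
apply: (@continuous_cvg _ _ _ _ _ _ (fun u : R => u ^+ 2)).
  exact: exprn_continuous.
apply: cvg_norm; apply: (cvg_big (op := +%R) (@add_continuous _)) => i _.
by apply: cvgZr_tmp.
Qed.

Let lind_complete (F : set_system lindenstrauss) :
  ProperFilter F -> cauchy F -> cvg F.
Proof.
apply: (complete_of_evaluations (ev := fun z i => z i) (c := fun=> 1)
  (le_sn := le_sn)) => //.
- by move=> z i; rewrite mul1r; apply/le_coord/lind_normP.
- move=> G f l r GG fl fr k p kp.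
  have h := @cvg_block_norm G f l k p GG fl; apply: (cvgr_to_le h).
  by move: fr; apply: filterS => z; exact.
- move=> G l GG _ lc.
  have lE : lind_E l.
    have [t tl] := lc 1 ltr01.
    apply: (@lind_E_le_sn _ (1 + lind_norm t)) => k p kp.
    have -> : l = (l - lind_fun t) + lind_fun t by rewrite subrK.
    by rewrite (le_trans (block_normD _ _ _ _))// lerD ?lind_block//; exact: tl.
  suff lP : l \in lind_pred by exists (Lindenstrauss lP).
  apply/asboolP; split => //; apply/cvg_lim => //; apply/cvgrPdist_le => e e0.
  have e20 : 0 < e / 2 by rewrite divr_gt0.
  have [t tl] := lc _ e20.
  have t0 : series (fun i => t i *: x i) @ \oo --> (0 : X).
    by rewrite -(lind_Q0 t); exact/lind_cvg/lind_inE.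
  move/cvgrPdist_le : t0 => /(_ _ e20); apply: filterS => n.
  rewrite !sub0r !normrN => tn; rewrite [leRHS]splitr.
  have -> : series (fun i => l i *: x i) n = 
      series (fun i => (l i - t i) *: x i) n + series (fun i => t i *: x i) n.
    rewrite /series/= -big_split/=; apply: eq_bigr => i _.
    by rewrite -scalerDl subrK.
  rewrite (le_trans (ler_normD _ _))// lerD//.
  have [->|n0] := posnP n; first by rewrite /series/= big_geq// normr0 ltW.
  have := tl 1%N (fun j => if j is 0%N then 0%N else n).
  rewrite /block_norm big_ord1 sqrtr_sqr normr_id; apply.
  by split => //; case.
Qed.

HB.instance Definition _ := Uniform_isComplete.Build lindenstrauss lind_complete.


End lindenstrauss.

(* Main.v *)
Require Import Defs.
From HB Require Import structures.
From mathcomp Require Import all_boot all_order all_algebra.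
From mathcomp Require Import all_classical all_reals all_analysis.
From mathcomp Require Import ring lra.

(** Write [S n] for the partial sums of [a i *: x i].  The norm of the ambient space of
    sequences is then the 2-variation of the path [S] in [X], and an element of the
    Lindenstrauss space is a loop: a path of finite 2-variation that starts at 0 and
    comes back to 0 at infinity.  Such norms satisfy 2-estimates on successive blocks, and
    these are what forces the two Szlenk indices to be as small as possible.

    Smoothness of the space.  If a loop is inserted into another one at a time when the
    latter is at 0, a jump over the junction is the sum of a jump to 0 and a jump from 0;
    its square is at most twice the sum of their squares.  Counting twice the squared
    distances from 0 to the two ends of a walk therefore gives an equivalent gauge whose
    square is subadditive under concatenation ([loop_concat]).  A general [u] is
    almost at 0 after some time [N], so that the square of the gauge of [u + t z] is at
    most about [1 + t ^ 2] when [u] and [z] are in the unit ball of the gauge and [z]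
    vanishes before [N] ([loop_ball_smooth]).  Such vectors [z] almost norm the
    functionals that are weak* close to 0 ([dual_norm_zero_head]), because the heads of
    length [N] live in a space of finite dimension and each head of a vector can be
    completed, at a bounded cost, to a loop.  The completion exists as the terms of
    the sequence [x] beyond any index are, up to sign, dense enough in the sphere to
    expand any vector greedily ([tail_lift], [head_lift]).

    Smoothness of the dual.  By the smoothness of the space, the restriction of a
    functional to vectors with zero head tends to 0, so that the coordinate functionals
    span a dense subspace of the dual ([dual_zero_head_small], with the Hahn-Banach
    theorem).  Hence the norm of an element [h] of the bidual is equivalent to the
    2-variation of the path whose coefficients are the values of [h] at the coordinate
    functionals ([bidual_norm_le]).  This variation is a supremum over block functionals,
    which satisfy an upper 2-estimate for successive blocks by definition, and those
    that start late almost norm the elements of the bidual that are weak* close to 0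
    ([bidual_norm_tail]).

    In both cases smoothness of power type 2 means that a derivation of step [e] reduces
    the radius of a ball of the dual gauge by a fixed amount, so that finitely many
    derivations exhaust the ball ([szlenk_upper]).  Conversely no fixed finite number of
    derivations suffices for all [e], because the space has infinite dimension
    ([szlenk_lower]). *)

Set Implicit Arguments.
Unset Strict Implicit.
Unset Printing Implicit Defensive.

Import Order.TTheory GRing.Theory Num.Theory.
Import numFieldNormedType.Exports.

Local Open Scope classical_set_scope.
Local Open Scope ring_scope.

(** * Bounded functionals and weak* neighbourhoods *)

Section dual_facts.
Variables (R : realType) (V : normedModType R).
Implicit Types (f g h : dual V) (v : V).

Lemma dual_build (l : V -> R) (c : R) : (forall a u v, l (a *: u + v) = a * l u + l v) ->
  (forall v, `|l v| <= c * `|v|) -> exists g : dual V, forall v, g v = l v.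
Proof.
move=> ll lc; have lP : (l : V -> R^o) \in @dual_pred R V.
  apply/asboolP; split; first exact: ll.
  pose m := GRing.isLinear.Build R V R^o *:%R (l : V -> R^o) ll.
  pose L : {linear V -> R^o} := HB.pack (l : V -> R^o) m.
  apply: (linear_bounded_continuous L).1; apply/bounded_funP => r.
  exists (`|c| * `|r|) => v vr; apply: le_trans (lc v) _.
  rewrite (@le_trans _ _ (`|c| * `|v|))//; first by rewrite ler_wpM2r// ler_norm.
  by rewrite ler_wpM2l// (le_trans vr)// ler_norm.
by exists (Dual lP).
Qed.

Lemma dual0E v : (0 : dual V) v = 0. Proof. by []. Qed.

Lemma dualDE f g v : (f + g) v = (f v + g v : R). Proof. by []. Qed.

Lemma dualBE f g v : (f - g) v = (f v - g v : R). Proof. by []. Qed.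

Lemma dualZE (a : R) f v : (a *: f) v = (a * f v : R). Proof. by []. Qed.

Lemma dual_evalZ f (a : R) v : f (a *: v) = a * f v.
Proof. exact: linearZ. Qed.

Lemma dual_ext f g : (forall v, f v = g v) -> f = g.
Proof. by move=> fg; apply/val_inj/funext. Qed.

Lemma ler_dual f v (M : R) : `|f| <= M -> `|f v| <= M * `|v|.
Proof. by move=> fM; rewrite (le_trans (ler_dual_norm f v))// ler_wpM2r. Qed.

Lemma dual_norm_attained f (r : R) : 0 <= r -> r < `|f| ->
  exists2 v, `|v| <= 1 & r < f v.
Proof.
move=> r0 rf; apply: contrapT => nv.
suff : `|f| <= r by rewrite leNgt rf.
apply/ler_dualP => // v; have [->|v0] := eqVneq v 0.
  by rewrite linear0 !normr0 mulr0.
have H w : `|w| <= 1 -> f w <= r.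
  by move=> w1; rewrite leNgt; apply/negP => rw; apply: nv; exists w.
pose w := `|v|^-1 *: v.
have w1 : `|w| = 1 by rewrite normrZ normfV normr_id mulVf ?normr_eq0.
have fw : `|f w| <= r.
  by rewrite ler_norml H ?w1// andbT lerNl -[leLHS](linearN f) H// normrN w1.
have -> : v = `|v| *: w by rewrite scalerA mulfV ?normr_eq0// scale1r.
rewrite linearZ normrZ [`|_ *: w|]normrZ normr_id [leRHS]mulrCA ler_wpM2l//.
by rewrite w1 mulr1.
Qed.

End dual_facts.

Section weak_star.
Variables (R : realType) (V : completeNormedModType R).
Implicit Types (f g h : dual V) (v : V).

Lemma weak_star_nbhs_eval f v (d : R) : 0 < d ->
  nbhs (f : weak_star V) ([set g : dual V | `|f v - g v| < d] : set (weak_star V)).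
Proof.
move=> d0.
have /pointwise_cvgP/(_ v) cv : {ptws, (fun g : weak_star V => (g : dual V) : V -> R) @
    nbhs (f : weak_star V) --> (f : V -> R)}.
  exact: (@initial_continuous _ _ (fun f : dual V => (f : V -> R) : {ptws V -> R}) f).
by move/cvgrPdist_lt : cv => /(_ _ d0).
Qed.

Lemma weak_star_nbhs_evals f (vs : seq V) (d : R) : 0 < d ->
  nbhs (f : weak_star V)
    ([set g : dual V | forall v, v \in vs -> `|f v - g v| < d] : set (weak_star V)).
Proof.
move=> d0; elim: vs => [|v vs IHvs]; first by apply: filterS filterT => g _ w.
apply: filterS2 (weak_star_nbhs_eval f v d0) IHvs => g gv gvs w.
by rewrite inE => /predU1P[->//|]; exact: gvs.
Qed.

(** The filter generated by the sets of functionals that coincide with [f] at finitely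
    many vectors converges pointwise to [f]. *)
Lemma weak_star_nbhs_finite f (U : set (dual V)) :
  nbhs (f : weak_star V) (U : set (weak_star V)) ->
  exists vs : seq V, forall g, (forall v, v \in vs -> g v = f v) -> U g.
Proof.
move=> [_ [[B Bop <-] Bf BU]].
pose G : set_system (V -> R) := [set P | exists vs : seq V,
  forall g : V -> R, (forall v, v \in vs -> g v = f v) -> P g].
have GF : Filter G.
  constructor; first by exists [::].
    move=> P Q [vs Pvs] [ws Qws]; exists (vs ++ ws) => g gE; split.
      by apply: Pvs => v vvs; apply: gE; rewrite mem_cat vvs.
    by apply: Qws => v vws; apply: gE; rewrite mem_cat vws orbT.
  by move=> P Q PQ [vs Pvs]; exists vs => g gE; exact/PQ/Pvs.
have : {ptws, G --> (f : V -> R)}.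
  apply/pointwise_cvgP => v P /nbhs_singleton Pfv.
  by exists [:: v] => g gE /=; rewrite /preimage/= gE ?mem_head.
move=> /(_ B); rewrite nbhsE => -[|vs Bvs]; first by exists B.
by exists vs => g gE; apply: BU; exact: Bvs.
Qed.

End weak_star.

(** * Szlenk index equal to omega *)

Section szlenk_omega.
Variables (R : realType) (V : completeNormedModType R).
Implicit Types (f g h : dual V) (v : V) (n : nat).

Definition ord_nat n : Ord := iter n Osucc Ozero.

Local Notation ball := ([set f : dual V | `|f| <= 1]).

Lemma szlenk_eq_omega :
  (forall e : R, 0 < e -> exists n, szlenk_derived e ball (ord_nat n) = set0) ->
  (forall n, exists2 e : R, 0 < e & szlenk_derived e ball (ord_nat n) !=set0) ->
  eord_eq (szlenk V) (Some omega).
Proof.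
move=> up lo.
have epsP (e : {posnum R}) : exists a, [/\ szlenk_eps ball e%:num = Some a,
    szlenk_derived e%:num ball a = set0 & forall b,
    szlenk_derived e%:num ball b = set0 -> ord_le a b].
  rewrite /szlenk_eps /ord_inf; case: pselect => [A0|nA]; last first.
    by case: nA; have [//|n en] := up e%:num; exists (ord_nat n).
  by case: cid2 => a /= ae amin; exists a.
rewrite /szlenk /szlenk_set /eord_sup.
have nN : ~ exists e : {posnum R}, szlenk_eps ball e%:num = None.
  by move=> [e]; have [a [-> _ _]] := epsP e.
set p := pselect _; destruct p as [ex|nex]; first by case: nN.
split=> /=.
  move=> e; have [a [-> /= _ amin]] := epsP e.
  have [//|n en] := up e%:num.
  by apply: (@ord_le_sup _ _ n); exact: amin.
move=> n; have [e e0 [f fn]] := lo n.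
apply: (@ord_le_sup _ _ (PosNum e0)); have [a [-> /= ae _]] := epsP (PosNum e0).
have [an|/ord_ltW//] := ord_le_total a (ord_nat n).
by have := szlenk_derived_anti an fn; rewrite ae.
Qed.

(** Weak* neighbourhoods are unbounded along the annihilator of a finite set of vectors,
    so that a derivation of step [e] of the ball of radius [r] still contains the ball of
    radius [r - e]. *)
Lemma szlenk_lower :
  (forall vs : seq V, exists2 g : dual V, g != 0 & forall v, v \in vs -> g v = 0) ->
  forall n, exists2 e : R, 0 < e & szlenk_derived e ball (ord_nat n) !=set0.
Proof.
move=> infV n; pose e : R := n.+1%:R^-1.
have e0 : 0 < e by rewrite invr_gt0.
have H m f : `|f| <= 1 - m%:R * e -> szlenk_derived e ball (ord_nat m) f.
  elim: m f => [|m IHm] f /=; first by rewrite mul0r subr0.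
  rewrite -natr1 mulrDl mul1r => fm; split; first by apply: IHm; lra.
  move=> U /weak_star_nbhs_finite[vs Uvs].
  have [g0 g00 g0vs] := infV vs.
  pose g := (e / `|g0|) *: g0.
  have ge : `|g| = e.
    by rewrite normrZ ger0_norm ?mulfVK ?normr_eq0// divr_ge0// ltW.
  have gvs v : v \in vs -> g v = 0 by move=> vvs; rewrite dualZE g0vs// mulr0.
  apply: ereal_sup_ubound; exists (f + g).
    split; first by apply: IHm; rewrite (le_trans (ler_normD _ _))// ge; lra.
    by apply: Uvs => v vvs; rewrite dualDE gvs// addr0.
  exists f; last by rewrite addrAC subrr add0r ge.
  by split; [apply: IHm; lra|exact: Uvs].
exists e => //; exists 0; apply: H; rewrite normr0 subr_ge0.
by rewrite ler_pdivrMr// mul1r ler_nat.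
Qed.

(** The set [A] plays the role of the unit ball of an equivalent norm on [V], and its
    polars [K r] that of the dual balls.  Let [f] be in the derived set of [K r].  If [f]
    exceeded [r - d] at a point [u] of [A], so would two neighbours [g1], [g2] of [f] at
    distance at least [e / 2], and [h = g1 - g2] would be weak* close to 0.  Hence, with
    the corresponding [z], the sum of [g1 (u + t z)] and [g2 (u - t z)] exceeds
    [2 (r - d) + t c e / 4], while it is at most [2 r (1 + 2 t ^ 2)]; this is absurd if [t]
    and then [d] are small.  So each derivation decreases [r] by [d]. *)
Lemma szlenk_upper (A : set V) (c : R) : 0 < c -> A 0 ->
  (forall u, A u -> `|u| <= 1) ->
  (forall u (t e : R), A u -> 0 < t -> t <= 1 -> 0 < e ->
    exists vs : seq V, exists2 d : R, 0 < d & forall h,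
      e <= `|h| -> (forall v, v \in vs -> `|h v| <= d) ->
      exists2 z, c * e <= h z &
        forall tau : R, `|tau| <= t -> A ((1 + 2 * t ^+ 2)^-1 *: (u + tau *: z))) ->
  forall e : R, 0 < e -> exists n, szlenk_derived e ball (ord_nat n) = set0.
Proof.
move=> c0 A0 A1 aus e e0.
pose K r := [set f : dual V | forall u, A u -> f u <= r].
pose b := c * (e / 4).
have b0 : 0 < b by rewrite mulr_gt0// divr_gt0.
pose t := Num.min 1 (b / 8).
have t0 : 0 < t by rewrite lt_min ltr01 divr_gt0.
have t1 : t <= 1 by rewrite ge_min lexx.
have tb : 8 * t <= b.
  have : t <= b / 8 by rewrite ge_min lexx orbT.
  by lra.
pose d := t * b / 4.
have d0 : 0 < d by rewrite divr_gt0// mulr_gt0.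
have step r : r <= 1 -> szlenk1 e (K r) `<=` K (r - d).
  move=> r1 f [Kf fU] u Au; rewrite leNgt; apply/negP => fu.
  have e40 : 0 < e / 4 by rewrite divr_gt0.
  have [vs [d' d'0 H]] := aus u t (e / 4) Au t0 t1 e40.
  have r0 : 0 <= r by have := Kf 0 A0; rewrite linear0.
  have fu' : 0 < f u - (r - d) by rewrite subr_gt0.
  have d'20 : 0 < d' / 2 by rewrite divr_gt0.
  have := fU _ (@filterI _ _ (nbhs_filter (f : weak_star V)) _ _
    (weak_star_nbhs_eval f u fu') (weak_star_nbhs_evals f vs d'20)).
  rewrite leNgt.
move=> /negP; apply; apply: (@le_lt_trans _ _ (e / 2)%:E); last first.
    by rewrite lte_fin; lra.
  apply: ge_ereal_sup => _ [g1 [Kg1 [g1u g1vs]] [g2 [Kg2 [g2u g2vs]] <-]].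
  rewrite lee_fin leNgt; apply/negP => g12.
  have [||z hz Az] := H (g1 - g2).
  - by rewrite (le_trans _ (ltW g12))//; lra.
  - move=> v vvs; rewrite dualBE.
    have := g1vs v vvs; have := g2vs v vvs; rewrite !ltr_norml ler_norml.
    by move=> /andP[? ?] /andP[? ?]; apply/andP; split; lra.
  have K2 g tau : K r g -> `|tau| <= t -> g u + tau * g z <= r * (1 + 2 * t ^+ 2).
    move=> Kg /Az/Kg; rewrite linearZ/= linearD linearZ/= ler_pdivrMl.
      by rewrite mulrC.
    by rewrite ltr_wpDr// mulr_ge0// sqr_ge0.
  have := K2 g1 t Kg1; rewrite gtr0_norm// => /(_ (lexx _)) /= g1t.
  have := K2 g2 (- t) Kg2; rewrite normrN gtr0_norm// => /(_ (lexx _)) /= g2t.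
  move: hz; rewrite dualBE -/b => hz.
  move: g1u g2u => /=; rewrite !ltr_norml => /andP[_ g1u] /andP[_ g2u].
  have rt : r * t ^+ 2 <= t ^+ 2 by rewrite ler_piMl// sqr_ge0.
  have tz : t * b <= t * (g1 z - g2 z) by rewrite ler_wpM2l// ltW.
  have tt : 8 * t ^+ 2 <= t * b by rewrite expr2 mulrCA ler_wpM2l// ltW.
  move: g1t g2t; rewrite mulrDr mulrCA mulNr => g1t g2t.
  rewrite /d in g1u g2u; rewrite mulrBr in tz.
  have tb0 : 0 < t * b by rewrite mulr_gt0.
  (* sum of the bounds for g1 (u + t z) and g2 (u - t z), where g1 u and g2 u exceed r - d *)
  have : t * b < 2 * d + 4 * t ^+ 2 by lra.
  by rewrite /d; lra.
have sub n : szlenk_derived e ball (ord_nat n) `<=` K (1 - n%:R * d).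
  elim: n => [|n IHn] /=.
    move=> f f1 u Au; rewrite mul0r subr0 (le_trans (ler_norm _))//.
    by rewrite (le_trans (ler_dual u f1))// mul1r A1.
  rewrite -natr1 mulrDl mul1r opprD addrA.
  apply: subset_trans (szlenk1S IHn) (step _ _).
  by rewrite gerBl mulr_ge0// ltW.
exists (Num.bound (d^-1)); apply/seteqP; split=> // f /sub/(_ 0 A0).
rewrite linear0 leNgt => /negP; apply; rewrite subr_lt0 -ltr_pdivrMr// mul1r.
by apply: archi_boundP; rewrite invr_ge0 ltW.
Qed.

End szlenk_omega.

(** * The Hahn-Banach theorem *)

Section hahn_banach.
Variables (R : realType) (V : lmodType R).
Implicit Types (q : V -> R) (C : set (V * R)) (v y : V) (a c : R).

(** Equality in the homogeneity condition follows by applying it to [a] and to its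
    inverse. *)
Definition sublinear q :=
  (forall u v, q (u + v) <= q u + q v) /\ (forall a v, 0 < a -> q (a *: v) <= a * q v).

Lemma sublinear0 q : sublinear q -> q 0 = 0.
Proof.
move=> [_ qZ]; apply/eqP; rewrite eq_le.
have := @qZ 2 0; have := @qZ 2^-1 0; rewrite !scaler0 invr_gt0 ltr0n.
by move=> /(_ isT) h1 /(_ isT) h2; apply/andP; split; lra.
Qed.

Lemma sublinear_oppl q v : sublinear q -> - q (- v) <= q v.
Proof. by move=> qs; have := qs.1 v (- v); rewrite subrr sublinear0//; lra. Qed.

(** A pair [(y, c)] stands for the constraint that the value at [y] be at most [c]. *)
Definition convex_cone C := [/\ C (0, 0),
  (forall p p', C p -> C p' -> C (p + p')) &
  (forall a p, 0 < a -> C p -> C (a *: p.1, a * p.2))].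

Lemma convex_cone_ray v c :
  convex_cone [set p | exists2 t, 0 <= t & p = (- (t *: v), - (t * c))].
Proof.
split.
- by exists 0 => //; rewrite scale0r mul0r !oppr0.
- move=> _ _ [t t0 ->] [t' t'0 ->]; exists (t + t'); first exact: addr_ge0.
  by rewrite scalerDl mulrDl !opprD.
- move=> a _ a0 [t t0 ->]; exists (a * t); first by rewrite mulr_ge0// ltW.
  by rewrite /= scalerN scalerA mulrN mulrA.
Qed.

(** The largest sublinear functional below [q] that meets the constraints in [C]. *)
Definition inf_conv q C v : R := inf [set q (v - p.1) + p.2 | p in C].

Section inf_conv.
Variables (q : V -> R) (C : set (V * R)).
Hypotheses (qs : sublinear q) (Cc : convex_cone C).
Hypothesis qC : forall p, C p -> - p.2 <= q (- p.1).

Lemma inf_conv_le v p : C p -> inf_conv q C v <= q (v - p.1) + p.2.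
Proof.
move=> Cp; apply: ge_inf; last by exists p.
exists (- q (- v)) => _ [p' Cp' <-]; have := qC Cp'.
have := qs.1 (v - p'.1) (- v); rewrite addrAC subrr add0r; lra.
Qed.

Lemma le_inf_conv v a : (forall p, C p -> a <= q (v - p.1) + p.2) -> a <= inf_conv q C v.
Proof.
move=> aC; apply: lb_le_inf; last by move=> _ [p Cp <-]; exact: aC.
by have [C0 _ _] := Cc; exists (q (v - 0) + 0), (0, 0).
Qed.

Lemma inf_conv_leq v : inf_conv q C v <= q v.
Proof. by have [/(inf_conv_le v) + _ _] := Cc; rewrite subr0 addr0. Qed.

Lemma inf_conv_constraint p : C p -> inf_conv q C p.1 <= p.2.
Proof. by move=> /(inf_conv_le p.1); rewrite subrr sublinear0// add0r. Qed.

Lemma inf_conv_sublinear : sublinear (inf_conv q C).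
Proof.
have [C0 CD CZ] := Cc; split=> [u v|a v a0].
  rewrite -lerBlDr; apply: le_inf_conv => p Cp; rewrite lerBlDr -lerBlDl.
  apply: le_inf_conv => p' Cp'; rewrite lerBlDl.
  apply: le_trans (inf_conv_le _ (CD _ _ Cp Cp')) _ => /=.
  by have := qs.1 (u - p.1) (v - p'.1); rewrite addrACA -opprD; lra.
rewrite -ler_pdivrMl//; apply: le_inf_conv => p Cp; rewrite ler_pdivrMl//.
apply: le_trans (inf_conv_le _ (CZ _ _ a0 Cp)) _ => /=.
by rewrite -scalerBr mulrDr lerD2r qs.2.
Qed.

End inf_conv.

(** The infimum of a chain of sublinear functionals below [q] is sublinear, so that
    Zorn's lemma applies. *)
Lemma sublinear_minimal q : sublinear q -> exists r,
  [/\ sublinear r, (forall v, r v <= q v) &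
   forall s, sublinear s -> (forall v, s v <= r v) -> forall v, r v <= s v].
Proof.
move=> qs; pose T := {r : V -> R | sublinear r /\ forall v, r v <= q v}.
pose t0 : T := exist _ q (conj qs (fun v => lexx _)).
pose ge (r s : T) := `[< forall v, sval s v <= sval r v >].
have [| |A Atot|[r [rs rq]] rmin] := @ZL_preorder T t0 ge.
- by move=> r; apply/asboolP.
- move=> r s t /asboolP rs /asboolP st; apply/asboolP => v.
  by rewrite (le_trans (st v)).
- have [[r0 Ar0]|nA] := pselect (exists r : T, A r); last first.
    by exists t0 => s As; case: nA; exists s.
  pose m v := inf [set sval r v | r in A].
  have m_le v (r : T) : A r -> m v <= sval r v.
    move=> Ar; apply: ge_inf; last by exists r.
    exists (- q (- v)) => _ [[s [ss sq]] As <-] /=.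
    by rewrite (le_trans _ (sublinear_oppl v ss))// lerN2.
  have m_ge v a : (forall r : T, A r -> a <= sval r v) -> a <= m v.
    move=> aA; apply: lb_le_inf; first by exists (sval r0 v), r0.
    by move=> _ [r Ar <-]; exact: aA.
  have ms : sublinear m.
    split=> [u v|a v a0].
      rewrite -lerBlDr; apply: (m_ge) => r Ar; rewrite lerBlDr -lerBlDl.
      apply: (m_ge) => s As; rewrite lerBlDl.
      have [/asboolP rs|/asboolP sr] := Atot _ _ Ar As.
        rewrite (le_trans (m_le _ _ As))// (le_trans ((svalP s).1.1 u v))//.
        by rewrite lerD2r.
      rewrite (le_trans (m_le _ _ Ar))// (le_trans ((svalP r).1.1 u v))//.
      by rewrite lerD2l.
    rewrite -ler_pdivrMl//; apply: (m_ge) => r Ar; rewrite ler_pdivrMl//.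
    by rewrite (le_trans (m_le _ _ Ar))// (svalP r).1.2.
  have mq v : m v <= q v by rewrite (le_trans (m_le v _ Ar0))// (svalP r0).2.
  by exists (exist _ m (conj ms mq)) => r Ar; apply/asboolP => v; exact: m_le.
exists r; split=> // s ss sr.
have sq v : s v <= q v by rewrite (le_trans (sr v)).
have /rmin/asboolP // : ge (exist _ r (conj rs rq)) (exist _ s (conj ss sq)).
exact/asboolP.
Qed.

(** A minimal sublinear functional [f] below [inf_conv q C] is linear: the constraints
    that the values at [- t v] be at most [- t (f v)], for [t >= 0], define a sublinear
    functional below [f], hence equal to [f], so that [f (- v)] is at most [- f v]. *)
Lemma hahn_banach q C : sublinear q -> convex_cone C ->
  (forall p, C p -> - p.2 <= q (- p.1)) ->
  exists f : V -> R, [/\ (forall a u v, f (a *: u + v) = a * f u + f v),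
    (forall v, f v <= q v) & forall p, C p -> f p.1 <= p.2].
Proof.
move=> qs Cc qC.
have [f [fs fp fmin]] := sublinear_minimal (inf_conv_sublinear qs Cc qC).
have fZ a v : 0 <= a -> f (a *: v) = a * f v.
  rewrite le_eqVlt => /predU1P[<-|a0].
    by rewrite scale0r mul0r sublinear0.
  apply/eqP; rewrite eq_le fs.2//= -ler_pdivlMl// (le_trans _ (fs.2 _ _ _)) ?invr_gt0//.
  by rewrite scalerA mulVf ?scale1r// gt_eqF.
have fN v : f (- v) = - f v.
  apply/eqP; rewrite eq_le; apply/andP; split; last first.
    by rewrite lerNl; have := sublinear_oppl v fs.
  pose D : set (V * R) := [set p | exists2 t, 0 <= t & p = (- (t *: v), - (t * f v))].
  have D1 : D (- v, - f v) by exists 1 => //; rewrite scale1r mul1r.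
  have Dc : convex_cone D by exact: convex_cone_ray.
  have fD p : D p -> - p.2 <= f (- p.1) by move=> [t t0 ->] /=; rewrite !opprK fZ.
  have := fmin _ (inf_conv_sublinear fs Dc fD) (inf_conv_leq fs Dc fD) (- v).
  by move=> /le_trans; apply; exact: (inf_conv_constraint fs fD D1).
have fD u v : f (u + v) = f u + f v.
  apply/eqP; rewrite eq_le fs.1/=; have := fs.1 (- u) (- v).
  by rewrite -opprD !fN; lra.
exists f; split=> [a u v|v|p Cp].
- rewrite fD; congr (_ + _); have [a0|a0] := leP 0 a; first exact: fZ.
  by rewrite -[a *: u]opprK -scaleNr fN fZ ?oppr_ge0 ?ltW// mulNr opprK.
- exact: le_trans (fp v) (inf_conv_leq qs Cc qC v).
- exact: le_trans (fp _) (inf_conv_constraint qs qC Cp).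
Qed.

End hahn_banach.

Section normed_hahn_banach.
Variables (R : realType) (V : normedModType R).
Implicit Types (f g : dual V) (v : V).

Lemma sublinear_norm (a : R) : 0 <= a -> sublinear (fun v : V => a * `|v|).
Proof.
move=> a0; split=> [u v|b v b0]; first by rewrite -mulrDr ler_wpM2l// ler_normD.
by rewrite normrZ gtr0_norm// mulrCA.
Qed.

Lemma hahn_banach_norm (C : set (V * R)) (a : R) : 0 <= a -> convex_cone C ->
  (forall p, C p -> - p.2 <= a * `|p.1|) ->
  exists2 g : dual V, `|g| <= a & forall p, C p -> g p.1 <= p.2.
Proof.
move=> a0 Cc Ca; have [|l [ll la lC]] := hahn_banach (sublinear_norm a0) Cc.
  by move=> p /Ca; rewrite normrN.
have l' v : `|l v| <= a * `|v|.
  rewrite ler_norml la andbT lerNl (_ : - l v = l (- v)) -?[in leRHS](normrN v) ?la//.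
  have := ll (-1) v 0; have := ll 1 0 0; rewrite scaleN1r scaler0 !addr0 mul1r; lra.
have [g gl] := dual_build ll l'; exists g; last by move=> p Cp; rewrite gl lC.
by apply/ler_dualP => // v; rewrite gl.
Qed.

Lemma norming_functional v : exists2 g : dual V, `|g| <= 1 & g v = `|v|.
Proof.
pose C : set (V * R) := [set p | exists2 t, 0 <= t & p = (- (t *: v), - (t * `|v|))].
have [||p [t t0 ->] /=|g g1 gv] := @hahn_banach_norm C 1.
- by [].
- exact: convex_cone_ray.
- by rewrite opprK normrN normrZ mul1r ger0_norm.
exists g => //; apply/eqP; rewrite eq_le; apply/andP; split.
  by rewrite (le_trans (ler_norm _))// (le_trans (ler_dual v g1))// mul1r.
have := gv (- v, - `|v|); rewrite /= linearN lerN2; apply.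
by exists 1 => //; rewrite scale1r mul1r.
Qed.

(** The constraints on a subspace are equalities, as they also hold for the opposite
    vectors. *)
Lemma dual_extension (S : set V) f (a : R) : 0 <= a ->
  S 0 -> (forall (b : R) u v, S u -> S v -> S (b *: u + v)) ->
  (forall v, S v -> `|f v| <= a * `|v|) ->
  exists2 g : dual V, `|g| <= a & forall v, S v -> g v = f v.
Proof.
move=> a0 S0 SL fS; pose C : set (V * R) := [set p | S p.1 /\ p.2 = f p.1].
have SZ (b : R) u : S u -> S (b *: u) by move=> Su; rewrite -[_ *: _]addr0; exact: SL.
have [||p [Sp ->] /=|g ga gC] := @hahn_banach_norm C a.
- by [].
- split.
  + by split; rewrite /= ?linear0.
  + move=> p p' [Sp pE] [Sp' p'E]; split=> /=; last by rewrite pE p'E linearD.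
    by rewrite -[p.1]scale1r; exact: SL.
  + move=> b p b0 [Sp pE]; split=> /=; first exact: SZ.
    by rewrite pE linearZ.
- by rewrite lerNl; have := fS _ Sp; rewrite ler_norml => /andP[].
exists g => // v Sv; apply/eqP; rewrite eq_le (gC (v, f v))//=.
have := gC (- v, f (- v)); rewrite /= !linearN lerN2; apply; split=> /=; last by rewrite linearN.
by rewrite -scaleN1r; exact: SZ.
Qed.

End normed_hahn_banach.

(** * Quadratic variation of paths *)

Section paths.
Variables (R : realType) (X : normedModType R).
Implicit Types (s : nat -> X) (t n N : nat) (l : seq nat) (k c a b : R).

Fixpoint walk s t l : R :=
  if l is t' :: l' then `|s t' - s t| ^+ 2 + walk s t' l' else 0.

(** The extra terms pay for the jump that straddles the junction of two paths, so that
    this energy is subadditive under concatenation; see [loop_concat]. *)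
Definition loop s t l : R :=
  2 * `|s t| ^+ 2 + walk s t l + 2 * `|s (last t l)| ^+ 2.

Lemma walk_ge0 s t l : 0 <= walk s t l.
Proof. by elim: l t => [//|t' l IHl] t /=; rewrite addr_ge0// sqr_ge0. Qed.

Lemma loop_ge0 s t l : 0 <= loop s t l.
Proof. by rewrite !addr_ge0 ?walk_ge0// mulr_ge0// sqr_ge0. Qed.

Lemma loop_cons s t t' l :
  loop s t (t' :: l) = 2 * `|s t| ^+ 2 + `|s t' - s t| ^+ 2 + (loop s t' l - 2 * `|s t'| ^+ 2).
Proof. by rewrite /loop /=; lra. Qed.

Lemma eq_walk s s' t l : (forall n, (t <= n)%N -> s n = s' n) -> path leq t l ->
  walk s t l = walk s' t l.
Proof.
elim: l t => [//|t' l IHl] t ss' /= /andP[tt' pl]; rewrite !ss'//; congr (_ + _).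
by apply: IHl => // n t'n; rewrite ss'// (leq_trans tt').
Qed.

Lemma path_leq_last t l : path leq t l -> (t <= last t l)%N.
Proof.
elim: l t => [//|t' l IHl] t /= /andP[tt' pl].
by rewrite (leq_trans tt')// IHl.
Qed.

Lemma eq_loop s s' t l : (forall n, (t <= n)%N -> s n = s' n) -> path leq t l ->
  loop s t l = loop s' t l.
Proof. by move=> ss' pl; rewrite /loop (eq_walk ss')// !ss'// path_leq_last. Qed.

Lemma walk_comp s (f : nat -> nat) t l : walk (s \o f) t l = walk s (f t) (map f l).
Proof. by elim: l t => [//|t' l IHl] t /=; rewrite IHl. Qed.

Lemma path_leq_map (f : nat -> nat) t l : {homo f : m n / (m <= n)%N} ->
  path leq t l -> path leq (f t) (map f l).
Proof. by move=> fh; exact: homo_path. Qed.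

Lemma walkZ c s t l : walk (fun n => c *: s n) t l = c ^+ 2 * walk s t l.
Proof.
elim: l t => [|t' l IHl] t /=; first by rewrite mulr0.
by rewrite IHl -scalerBr normrZ exprMn real_normK ?num_real// mulrDr.
Qed.

Lemma loopZ c s t l : loop (fun n => c *: s n) t l = c ^+ 2 * loop s t l.
Proof.
by rewrite /loop walkZ !normrZ !exprMn !real_normK ?num_real//; lra.
Qed.

Lemma sqr_normD k (u v : X) : 0 < k ->
  `|u + v| ^+ 2 <= (1 + k) * `|u| ^+ 2 + (1 + k^-1) * `|v| ^+ 2.
Proof.
move=> k0; rewrite (@le_trans _ _ ((`|u| + `|v|) ^+ 2))//.
  by rewrite ler_pXn2r ?nnegrE ?addr_ge0// ler_normD.
have kV : k * k^-1 = 1 by rewrite divff// gt_eqF.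
have := mulr_ge0 (ltW k0) (sqr_ge0 (`|u| - k^-1 * `|v|)).
have -> : k * (`|u| - k^-1 * `|v|) ^+ 2 =
  k * `|u| ^+ 2 - 2 * (k * k^-1) * (`|u| * `|v|) + (k * k^-1) * k^-1 * `|v| ^+ 2 by ring.
by rewrite kV; lra.
Qed.

Lemma walkD k s s' t l : 0 < k ->
  walk (fun n => s n + s' n) t l <= (1 + k) * walk s t l + (1 + k^-1) * walk s' t l.
Proof.
move=> k0; elim: l t => [|t' l IHl] t /=; first by rewrite !mulr0 addr0.
have := sqr_normD (s t' - s t) (s' t' - s' t) k0; rewrite addrACA -opprD.
by have := IHl t'; lra.
Qed.

Lemma loopD k s s' t l : 0 < k ->
  loop (fun n => s n + s' n) t l <= (1 + k) * loop s t l + (1 + k^-1) * loop s' t l.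
Proof.
move=> k0; rewrite /loop; have := walkD s s' t l k0.
have := sqr_normD (s t) (s' t) k0; have := sqr_normD (s (last t l)) (s' (last t l)) k0.
lra.
Qed.

(** The jump from the first part to the second one is estimated by
    [(a + b) ^ 2 <= 2 a ^ 2 + 2 b ^ 2], which closes one loop and opens the other. *)
Lemma loop_concat s u w N a b :
  (forall n, (n < N)%N -> s n = u n) -> (forall n, (N <= n)%N -> s n = w n) ->
  (forall t l, path leq t l -> loop u t l <= a) ->
  (forall t l, path leq t l -> loop w t l <= b) ->
  forall t l, path leq t l -> loop s t l <= a + b.
Proof.
move=> su sw ua wb.
have a0 : 0 <= a by have := ua 0%N [::] isT; apply: le_trans; exact: loop_ge0.
have b0 : 0 <= b by have := wb 0%N [::] isT; apply: le_trans; exact: loop_ge0.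
have late t l : (N <= t)%N -> path leq t l -> loop s t l <= b.
  move=> Nt pl; rewrite (eq_loop (s' := w)) ?wb// => n tn.
  by rewrite sw// (leq_trans Nt).
have early t l : (t < N)%N -> path leq t l -> exists2 l', path leq t l' &
    loop s t l <= loop u t l' + b.
  elim: l t => [|t' l IHl] t tN.
    by exists [::] => //; rewrite /loop /= su// lerDl.
  move=> /= /andP[tt' pl]; rewrite loop_cons; have [Nt'|t'N] := leqP N t'.
    exists [::] => //; have := late t' l Nt' pl; have := sqr_normD (s t') (- s t) ltr01.
    by rewrite normrN invr1 /loop /= !(su t)//; lra.
  have [l' pl' sl'] := IHl t' t'N pl; exists (t' :: l'); first by rewrite /= tt'.
  by rewrite loop_cons !(su t)// !(su t')//; lra.
move=> t l pl; have [Nt|tN] := leqP N t.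
  by rewrite (le_trans (late t l Nt pl))// lerDr.
have [l' pl' sl'] := early t l tN pl.
by rewrite (le_trans sl')// lerD2r ua.
Qed.

Lemma walk_cat s t l m : walk s t (l ++ m) = walk s t l + walk s (last t l) m.
Proof. by elim: l t => [|t' l IHl] t /=; rewrite ?add0r// IHl addrA. Qed.

Lemma walk_strict s t l : path leq t l -> exists2 m, path ltn t m & walk s t l = walk s t m.
Proof.
elim: l t => [|t' l IHl] t /=; first by exists [::].
move=> /andP[tt' /IHl[m pm ->]]; move: tt'; rewrite leq_eqVlt => /predU1P[->|tt'].
  by exists m => //; rewrite subrr normr0 expr0n add0r.
by exists (t' :: m); rewrite //= tt'.
Qed.

Lemma walk_sum s t l : walk s t l =
  \sum_(j < size l) `|s (nth 0%N (t :: l) j.+1) - s (nth 0%N (t :: l) j)| ^+ 2.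
Proof.
elim: l t => [|t' l IHl] t /=; first by rewrite big_ord0.
by rewrite big_ord_recl/= IHl.
Qed.

(** A walk that starts after the end of a nearly optimal one can be appended to it. *)
Lemma walk_tail s (M e : R) : 0 < e -> (forall l, path leq 0%N l -> walk s 0 l <= M) ->
  exists N, forall t l, (N <= t)%N -> path leq t l -> walk s t l <= e.
Proof.
move=> e0 sM; pose E := [set walk s 0 l | l in [set l | path leq 0%N l]].
have Esup : has_sup E.
  by split; [exists 0, [::]|exists M => _ [l pl <-]; exact: sM].
have [_ [l pl <-] lE] := sup_adherent e0 Esup.
exists (last 0%N l) => t m Nt pm.
have := ub_le_sup (proj2 Esup); move=> /(_ (walk s 0 (l ++ t :: m))).
have -> : walk s 0 (l ++ t :: m) =
    walk s 0 l + (`|s t - s (last 0%N l)| ^+ 2 + walk s t m) by rewrite walk_cat.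
have := sqr_ge0 `|s t - s (last 0%N l)| => h0 h.
have : E (walk s 0 l + (`|s t - s (last 0%N l)| ^+ 2 + walk s t m)).
  by exists (l ++ t :: m); rewrite ?walk_cat//= cat_path /= pl Nt.
by move=> /h; lra.
Qed.

(** Deleting an initial part of a path costs one jump, which is small if the path tends
    to 0. *)
Lemma loop_late s (e : R) N : (forall t, (N <= t)%N -> `|s t| ^+ 2 <= e) ->
  (forall t l, (N <= t)%N -> path leq t l -> walk s t l <= e) ->
  forall t l, path leq t l -> loop (fun n => if (n < N)%N then 0 else s n) t l <= 6 * e.
Proof.
move=> se we; have e0 : 0 <= e by apply: le_trans (se N _); rewrite ?sqr_ge0.
set s' := fun n => _; have s'e n : (N <= n)%N -> s' n = s n by rewrite /s' ltnNge => ->.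
have s'0 n : (n < N)%N -> s' n = 0 by rewrite /s' => ->.
have late t l : (N <= t)%N -> path leq t l -> loop s' t l <= 5 * e.
  move=> Nt pl; rewrite (eq_loop (s' := s))//; last first.
    by move=> n tn; rewrite s'e// (leq_trans Nt).
  have := we t l Nt pl; have := se t Nt; have := se _ (leq_trans Nt (path_leq_last pl)).
  by rewrite /loop; lra.
move=> t l; elim: l t => [|t' l IHl] t pl; have [Nt|tN] := leqP N t.
- by have := late t _ Nt pl; lra.
- by rewrite /loop /= s'0// normr0; lra.
- by have := late t _ Nt pl; lra.
move: pl => /= /andP[tt' pl]; rewrite loop_cons [s' t]s'0// subr0 normr0.
have [Nt'|t'N] := leqP N t'; last first.
  by have := IHl t' pl; rewrite [s' t']s'0// normr0; lra.
by have := late t' l Nt' pl; have := se t' Nt'; rewrite [s' t']s'e//; have := sqr_ge0 `|s t'|; lra.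
Qed.

End paths.

(** * The Lindenstrauss space as a space of loops *)

Section lindenstrauss_paths.
Variables (R : realType) (X : completeNormedModType R) (x : dense_sphere_seq X).
Implicit Types (a b : nat -> R) (n N : nat) (l : seq nat) (z w : lindenstrauss x).

Definition psum a : nat -> X := series (fun i => a i *: x i).

Lemma psum0 a : psum a 0 = 0.
Proof. by rewrite /psum /series/= big_geq. Qed.

Lemma psumS a n : psum a n.+1 = psum a n + a n *: x n.
Proof. by rewrite /psum /series/= big_nat_recr. Qed.

Lemma psum_block a m n : (m <= n)%N ->
  \sum_(m <= i < n) a i *: x i = psum a n - psum a m.
Proof.
move=> mn; rewrite /psum /series/= (@big_cat_nat _ _ _ m 0 n)//=.
by rewrite addrAC subrr add0r.
Qed.

Lemma psumD a b n : psum (fun i => a i + b i) n = psum a n + psum b n.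
Proof. by rewrite /psum /series/= -big_split; apply: eq_bigr => i _; rewrite scalerDl. Qed.

Lemma psumZ (c : R) a n : psum (fun i => c * a i) n = c *: psum a n.
Proof. by rewrite /psum /series/= scaler_sumr; apply: eq_bigr => i _; rewrite scalerA. Qed.

Lemma eq_psum a b n : (forall i, (i < n)%N -> a i = b i) -> psum a n = psum b n.
Proof. by move=> ab; apply: eq_big_nat => i /andP[_ iN]; rewrite ab. Qed.

Lemma lind_ext z w : (forall i, z i = w i) -> z = w.
Proof. by move=> zw; apply/val_inj/funext. Qed.

Lemma lind_cvg0 z : psum z @ \oo --> 0.
Proof. by rewrite -(lind_Q0 z); exact/lind_cvg/lind_inE. Qed.

Lemma lind_normE_le a (M : R) : 0 <= M ->
  (forall l, path leq 0%N l -> walk (psum a) 0 l <= M ^+ 2) -> (lind_normE x a <= M%:E)%E.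
Proof.
move=> M0 aM; apply: ge_ereal_sup => _ [[k p] /= [k0 p0 pS] <-]; rewrite lee_fin.
have pl : path leq 0%N (mkseq (fun j => p j.+1) k).
  apply/(pathP 0%N) => i; rewrite size_mkseq => ik.
  rewrite nth_mkseq//; case: i ik => [//|i] ik /=.
  by rewrite nth_mkseq ?(ltnW ik)// ltnW// pS.
have := aM _ pl; rewrite walk_sum size_mkseq => pM.
rewrite /block_norm -(ger0_norm M0) -sqrtr_sqr ler_sqrt ?sqr_ge0//.
rewrite (le_trans _ pM)// le_eqVlt; apply/orP; left; apply/eqP.
have pE (j : nat) : (j <= k)%N -> nth 0%N (0%N :: mkseq (fun j => p j.+1) k) j = p j.
  by case: j => [//|j] jk; rewrite /= nth_mkseq.
by apply: eq_bigr => j _; rewrite !pE ?(ltnW (ltn_ord j))// psum_block// ltnW// pS.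
Qed.

Lemma lind_norm_le z (M : R) : 0 <= M ->
  (forall l, path leq 0%N l -> walk (psum z) 0 l <= M ^+ 2) -> `|z| <= M.
Proof. by move=> M0 zM; rewrite -lee_fin lind_normE_val; exact: lind_normE_le. Qed.

Lemma lind_build a (M : R) : 0 <= M ->
  (forall l, path leq 0%N l -> walk (psum a) 0 l <= M ^+ 2) -> psum a @ \oo --> 0 ->
  exists2 z : lindenstrauss x, forall i, z i = a i & `|z| <= M.
Proof.
move=> M0 aM a0; have aP : a \in lind_pred x.
  apply/asboolP; split; last exact/cvg_lim.
  by rewrite /lind_E/= (le_lt_trans (lind_normE_le M0 aM))// ltry.
by exists (Lindenstrauss aP) => //; exact: lind_norm_le.
Qed.

Lemma walk_le_norm z l : path leq 0%N l -> walk (psum z) 0 l <= `|z| ^+ 2.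
Proof.
move=> /walk_strict-/(_ _ _ (psum z))[m pm ->].
have [->|m0] := eqVneq m [::]; first by rewrite /= sqr_ge0.
pose p := nth 0%N (0%N :: m).
have kp : cut_points (size m) p.
  split; [by rewrite lt0n size_eq0|by []|move=> j jm].
  by move/(pathP 0%N) : pm => /(_ j jm).
have : block_norm x z (size m) p <= `|z|.
  by rewrite -lee_fin lind_normE_val; apply: ereal_sup_ubound; exists (size m, p).
rewrite walk_sum -(ler_pXn2r (n := 2)) ?nnegrE ?sqrtr_ge0// sqr_sqrtr; last first.
  by apply: sumr_ge0 => j _; exact: sqr_ge0.
congr (_ <= _); apply: eq_bigr => j _; rewrite psum_block//.
by rewrite ltnW//; case: kp => _ _; apply.
Qed.

Lemma psum_le_norm z n : `|psum z n| <= `|z|.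
Proof.
have := walk_le_norm z (l := [:: n]) isT; rewrite /= addr0 psum0 subr0.
by rewrite ler_pXn2r ?nnegrE.
Qed.

Lemma coord_le_norm z i : `|z i| <= `|z|.
Proof.
have := walk_le_norm z (l := [:: i; i.+1]); rewrite /= leqnSn => /(_ isT).
rewrite addr0 psumS [psum z i + _]addrC addrK normrZ sphere_seq_norm mulr1.
have := sqr_ge0 `|psum z i - psum z 0| => h0 h.
rewrite -(ler_pXn2r (n := 2)) ?nnegrE//; lra.
Qed.

Lemma walk_l1 a (M : R) : (forall n, \sum_(i < n) `|a i| <= M) ->
  forall l, path leq 0%N l -> walk (psum a) 0 l <= M ^+ 2.
Proof.
move=> aM l pl; pose A n := \sum_(i < n) `|a i|.
have A0 n : 0 <= A n by apply: sumr_ge0.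
have An m n : (m <= n)%N -> `|psum a n - psum a m| <= A n - A m.
  move=> /subnK <-; elim: (n - m)%N => [|d IHd]; first by rewrite !subrr normr0.
  rewrite addSn psumS /A big_ord_recr/= addrAC [leRHS]addrAC.
  rewrite (le_trans (ler_normD _ _))// lerD//.
  by rewrite normrZ sphere_seq_norm mulr1.
have H t : path leq t l -> walk (psum a) t l <= (A (last t l) - A t) ^+ 2.
  elim: l t {pl} => [|t' l IHl] t /=; first by rewrite sqr_ge0.
  move=> /andP[tt' pl]; have := IHl t' pl; have := An _ _ tt'.
  have := An _ _ (path_leq_last pl); set L := A _; set A' := A _; set A1 := A _.
  move=> L0 h1 h2.
  have h3 : 0 <= A' - A1 by rewrite (le_trans _ h1).
  have h4 : 0 <= L - A' by rewrite (le_trans _ L0).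
  have : `|psum a t' - psum a t| ^+ 2 <= (A' - A1) ^+ 2 by rewrite ler_pXn2r ?nnegrE.
  by have := mulr_ge0 h3 h4; nra.
apply: le_trans (H 0%N pl) _; rewrite {2}/A big_ord0 subr0.
by rewrite ler_pXn2r ?nnegrE// ?(le_trans (A0 0%N))// aM.
Qed.

Definition head a N i : R := if (i < N)%N then a i else 0.

Lemma psum_head a N : psum (head a N) = psum a \o minn^~ N.
Proof.
apply/funext => n /=; elim: n => [|n IHn]; first by rewrite min0n !psum0.
rewrite psumS IHn /head; case: ltnP => [nN|Nn].
  by rewrite (minn_idPl nN) psumS.
by rewrite (minn_idPr (leqW Nn)) scale0r addr0.
Qed.

Lemma walk_head a N (d : R) : 0 <= d -> (forall i, (i < N)%N -> `|a i| <= d) ->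
  forall l, path leq 0%N l -> walk (psum (head a N)) 0 l <= (N%:R * d) ^+ 2.
Proof.
move=> d0 ad; apply: walk_l1 => n.
have H m : \sum_(i < m) `|head a N i| <= (minn m N)%:R * d.
  elim: m => [|m IHm]; first by rewrite big_ord0 min0n mul0r.
  rewrite big_ord_recr/= {2}/head; case: ltnP => mN.
    rewrite (minn_idPl mN) -natr1 mulrDl mul1r lerD ?ad//.
    by rewrite (le_trans IHm)// (minn_idPl (ltnW mN)).
  by rewrite normr0 addr0 (minn_idPr (leqW mN)) (le_trans IHm)// (minn_idPr mN).
by rewrite (le_trans (H n))// ler_wpM2r// ler_nat geq_minr.
Qed.

(** * Lifting vectors to tails *)

(** If [X] is the line spanned by [y], each term of the sequence is [y] or [- y].
    Otherwise take [v] outside of this line: for small [s > 0], the normalization of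
    [y + s v] is a unit vector close to [y] that differs from the first [N] terms of the
    sequence, so that the terms close enough to that vector have an index at least [N]. *)
Lemma sphere_seq_tail (y : X) N : `|y| = 1 ->
  exists2 m, (N <= m)%N & `|y - x m| <= 2^-1 \/ `|y + x m| <= 2^-1.
Proof.
move=> y1; have y0 : y != 0 by rewrite -normr_eq0 y1 oner_eq0.
have [ally|/existsNP[v vy]] := pselect (forall v : X, exists c : R, v = c *: y).
  have [c xc] := ally (x N); exists N => //.
  have c1 : `|c| = 1 by have := sphere_seq_norm x N; rewrite xc normrZ y1 mulr1.
  have [c0|c0] := leP 0 c; move: c1.
    rewrite ger0_norm// => c1; left; rewrite xc c1 scale1r subrr normr0.
    by rewrite invr_ge0.
  rewrite ltr0_norm// => c1; right; rewrite xc -[c]opprK c1 scaleN1r subrr normr0.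
  by rewrite invr_ge0.
pose u (s : R) : X := `|y + s *: v|^-1 *: (y + s *: v).
have uc : u s @[s --> 0^'+] --> y.
  have yc : (y + s *: v) @[s --> 0^'+] --> y.
    rewrite -[X in _ --> X]addr0 -(scale0r v); apply: cvgD; first exact: cvg_cst.
    by apply: cvgZr_tmp; apply: cvg_within_filter; exact: cvg_id.
  rewrite -[X in _ --> X]scale1r; apply: cvgZ => //.
  by rewrite -invr1 -y1; apply: cvgV; [rewrite normr_eq0|exact: cvg_norm].
have ux : \forall s \near (0 : R)^'+, forall i, (i < N)%N -> u s != x i.
  elim: (N) => [|M IHM]; first by near=> s.
  have uM : \forall s \near (0 : R)^'+, u s != x M.
    have [xM|xM] := eqVneq (x M) y.
      near=> s; rewrite xM; apply/eqP => us; apply: vy.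
      have s0 : s != 0 by rewrite gt_eqF//; near: s; exact: nbhs_right_gt.
      have ys0 : `|y + s *: v| != 0.
        by apply: contra_neq y0 => ys; rewrite -us /u ys invr0 scale0r.
      exists (s^-1 * (`|y + s *: v| - 1)); rewrite -scalerA scalerBl scale1r.
      have -> : `|y + s *: v| *: y = y + s *: v.
        by rewrite -[X in _ *: X]us scalerA mulfV// scale1r.
      by rewrite addrAC subrr add0r scalerA mulVf ?scale1r.
    have d0 : 0 < `|y - x M| by rewrite normr_gt0 subr_eq0 eq_sym.
    move/cvgrPdist_lt : uc => /(_ _ d0); apply: filterS => s.
    by apply: contraTneq => ->; rewrite ltxx.
  apply: filterS2 IHM uM => s us uM i; rewrite ltnS leq_eqVlt => /predU1P[->//|].
  exact: us.
have [s [us1 us us2]] : exists s, [/\ `|u s| = 1, forall i, (i < N)%N -> u s != x i &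
    `|y - u s| <= 4^-1].
  have e0 : 0 < (4^-1 : R) by rewrite invr_gt0.
  have /cvgrPdist_le/(_ _ e0) h1 := uc.
  have [s [h2 h3]] := @filter_ex _ _ (at_right_proper_filter (0 : R)) _ (filterI ux h1).
  exists s; split=> //; rewrite /u normrZ normfV normr_id mulVf//.
  apply/eqP => ys; move: h3; rewrite /u ys invr0 scale0r subr0 y1.
  by lra.
have [r r0 rN] : exists2 r : R, 0 < r & forall i, (i < N)%N -> r <= `|u s - x i|.
  elim: (N) us => [|M IHM] us; first by exists 1.
  have [|r r0 rM] := IHM; first by move=> i iM; apply: us; rewrite ltnW.
  exists (Num.min r `|u s - x M|).
    by rewrite lt_min r0 normr_gt0 subr_eq0 us.
  move=> i; rewrite ltnS leq_eqVlt => /predU1P[->|iM]; first by rewrite ge_min lexx orbT.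
  by rewrite ge_min rM.
have d0 : 0 < Num.min r 4^-1 by rewrite lt_min r0 invr_gt0 ltr0n.
have := @sphere_seq_dense _ _ x _ us1 _ (nbhsx_ballx (u s) _ d0).
move=> [_ [[m _ <-]]].
rewrite -ball_normE/= lt_min => /andP[xr x4]; exists m.
  by rewrite leqNgt; apply/negP => /rN; rewrite leNgt xr.
left; rewrite (le_trans (ler_distD (u s) _ _))//.
by move: x4 us2; set A := `|_|; set B := `|_|; lra.
Unshelve. all: by end_near. Qed.

(** The coefficient is, up to sign, the norm of [v], so that the norm decreases by at
    least half of it when the step is taken; this makes the coefficients of the greedy
    expansion absolutely summable. *)
Definition greedy_coef N t (v : X) : R :=
  if (t < N)%N then 0
  else if `|v - `|v| *: x t| <= `|v| / 2 then `|v|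
  else if `|v + `|v| *: x t| <= `|v| / 2 then - `|v|
  else 0.

Fixpoint residual N (v : X) t : X :=
  if t is t'.+1 then residual N v t' - greedy_coef N t' (residual N v t') *: x t' else v.

Lemma residual_step N v t :
  `|residual N v t.+1| + `|greedy_coef N t (residual N v t)| / 2 <= `|residual N v t|.
Proof.
rewrite /=; set r := residual N v t; rewrite /greedy_coef.
case: ifP => _; first by rewrite scale0r subr0 normr0 mul0r addr0.
case: ifP => [h|_]; first by rewrite normr_id; lra.
case: ifP => [h|_]; first by rewrite scaleNr opprK normrN normr_id; lra.
by rewrite scale0r subr0 normr0 mul0r addr0.
Qed.

(** The coefficients of the greedy expansion are summable by [residual_step], and the
    residual tends to 0 because, by [sphere_seq_tail], it is halved infinitely often,
    unless it vanishes. *)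
Lemma tail_lift N (v : X) : exists a, [/\ (forall i, (i < N)%N -> a i = 0),
  (forall n, \sum_(i < n) `|a i| <= 2 * `|v|) & psum a @ \oo --> v].
Proof.
pose r := residual N v; pose a t := greedy_coef N t (r t).
have ar n : psum a n = v - r n.
  elim: n => [|n IHn]; first by rewrite psum0 subrr.
  by rewrite psumS IHn /r /= opprB addrA addrAC.
have rle m n : (m <= n)%N -> `|r n| <= `|r m|.
  move=> /subnK <-; elim: (n - m)%N => [//|d]; apply: le_trans.
  rewrite addSn.
  by have := residual_step N v (d + m); have := normr_ge0 (a (d + m)%N); rewrite /a /r; lra.
exists a; split.
- by move=> i iN; rewrite /a /greedy_coef iN.
- move=> n; suff : \sum_(i < n) `|a i| + 2 * `|r n| <= 2 * `|v|.

  by have := normr_ge0 (r n); lra.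
  elim: n => [|n IHn]; first by rewrite big_ord0 add0r.
  by rewrite big_ord_recr/=; have := residual_step N v n; rewrite -/(a n) -/(r n) -/(r n.+1); lra.
have r2 n : r n.+1 = r n \/ `|r n.+1| <= `|r n| / 2.
  rewrite /r /= /greedy_coef; case: ifP => _; first by left; rewrite scale0r subr0.
  case: ifP => [|_]; first by right.
  case: ifP => [|_]; first by right; rewrite scaleNr opprK.
  by left; rewrite scale0r subr0.
have half n : exists m, `|r m| <= `|r n| / 2.
  have [rn0|rn0] := eqVneq (r n) 0; first by exists n; rewrite rn0 normr0 mul0r.
  have rn1 : `| `|r n|^-1 *: r n| = 1.
    by rewrite normrZ normfV normr_id mulVf ?normr_eq0.
  have [m nm hm] := sphere_seq_tail (maxn n N) rn1.
  move: nm; rewrite geq_max => /andP[nm Nm].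
  have [rm|] : r m = r n \/ `|r m| <= `|r n| / 2; last by exists m.
    rewrite -(subnK nm); elim: (m - n)%N => [|d IHd]; first by left.
    rewrite addSn; have := r2 (d + n)%N; have := rle _ _ (leq_addl d n).
    move=> h [->//|h']; right; rewrite (le_trans h')//.
    by rewrite ler_pM2r ?invr_gt0.
  have scale (b : R) : `| `|r n|^-1 *: r n + b *: x m| <= 2^-1 ->
      `|r n + (b * `|r n|) *: x m| <= `|r n| / 2.
    have -> : r n + (b * `|r n|) *: x m = `|r n| *: (`|r n|^-1 *: r n + b *: x m).
      by rewrite scalerDr !scalerA mulfV ?normr_eq0// scale1r mulrC.
    by rewrite normrZ normr_id; apply: ler_wpM2l.
  exists m.+1; rewrite /r /= -/(r m) rm /greedy_coef ltnNge Nm/=.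
  case: ifP => // hp; case: ifP => [|hn]; first by rewrite scaleNr opprK.
  case: hm => hm.
    by have := scale (-1); rewrite scaleN1r mulN1r scaleNr hp; move=> /(_ hm).
  by have := scale 1; rewrite scale1r mul1r hn; move=> /(_ hm).
have small k : exists m, `|r m| <= `|v| / 2 ^+ k.
  elim: k => [|k [m rm]]; first by exists 0%N; rewrite expr0 divr1.
  have [m' rm'] := half m; exists m'; rewrite (le_trans rm')//.
  by rewrite exprSr invfM mulrA ler_pM2r ?invr_gt0.
apply/cvgrPdist_le => e e0; have [m rm] := small (Num.bound (`|v| / e)).
exists m => // n /= mn; rewrite ar opprB addrCA subrr addr0.
rewrite (le_trans (rle _ _ mn))// (le_trans rm)// ler_pdivrMr ?exprn_gt0//.
rewrite mulrC -ler_pdivrMr//; apply: le_trans (ltW (archi_boundP _)) _.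
  by rewrite divr_ge0// ltW.
by rewrite -natrX ler_nat ltnW// ltn_expl.
Qed.

(** The head of [a] leads to the point [psum a N], and [tail_lift] brings the path from
    there back to 0. *)
Lemma head_lift a N (M : R) : 0 <= M ->
  (forall l, path leq 0%N l -> walk (psum a) 0 l <= M ^+ 2) ->
  exists2 z : lindenstrauss x, forall i, (i < N)%N -> z i = a i & `|z| <= 4 * M.
Proof.
move=> M0 aM; pose h := head a N.
have hM l : path leq 0%N l -> walk (psum h) 0 l <= M ^+ 2.
  move=> pl; rewrite psum_head walk_comp min0n aM// -(min0n N).
  apply: (path_leq_map (f := minn^~ N)) pl.
  by move=> m n mn; rewrite leq_min (leq_trans (geq_minl _ _) mn) geq_minr.
have aN : `|psum a N| <= M.
  have := aM [:: N] isT; rewrite /= addr0 psum0 subr0.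
  by rewrite ler_pXn2r ?nnegrE.
have [w [w0 w1 wc]] := tail_lift N (- psum a N).
have [|||z zE zM] := @lind_build (fun i => h i + w i) (4 * M).
- by rewrite mulr_ge0.
- move=> l pl; have -> : psum (fun i => h i + w i) = fun n => psum h n + psum w n.
    by apply/funext => n; rewrite psumD.
  (* the bounds add up to 2 M ^ 2 + 2 (2 M) ^ 2 <= (4 M) ^ 2 *)
  apply: le_trans (walkD _ _ _ _ ltr01) _; rewrite invr1.
  have := hM l pl; have := walk_l1 w1 pl; rewrite normrN.
  have : (2 * `|psum a N|) ^+ 2 <= (2 * M) ^+ 2.
    by rewrite ler_pXn2r ?nnegrE ?mulr_ge0// ler_pM2l.
  by rewrite !exprMn; have := sqr_ge0 M; lra.
- have -> : psum (fun i => h i + w i) = fun n => psum h n + psum w n.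
    by apply/funext => n; rewrite psumD.
  rewrite -(subrr (psum a N)); apply: cvgD wc; apply: cvg_near_cst.
  by exists N => // n /= Nn; rewrite psum_head /= (minn_idPr Nn).
by exists z => // i iN; rewrite zE w0// addr0 /h /head iN.
Qed.

End lindenstrauss_paths.

(** * Asymptotic smoothness of the Lindenstrauss space *)

(** The values of the last coordinate on [B] lie in [[-1, 1]], which is cut into intervals
    of length [e]; the slices of [B] over these intervals have nets for the other
    coordinates. *)
Lemma finite_net (R : realType) (T : choiceType) (ev : T -> nat -> R) (e : R) N (B : set T) :
  0 < e -> (forall b i, B b -> `|ev b i| <= 1) ->
  exists2 L : seq T, (forall y, y \in L -> B y) &
    forall b, B b -> exists2 y, y \in L & forall i, (i < N)%N -> `|ev b i - ev y i| <= e.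
Proof.
move=> e0; elim: N B => [|N IHN] B B1.
  have [[b0 Bb0]|nB] := pselect (exists b, B b).
    by exists [:: b0] => [y|b Bb]; [rewrite inE => /eqP ->|exists b0; rewrite ?inE].
  by exists [::] => // b Bb; case: nB; exists b.
have netS (C : set T) c : (forall b, C b -> B b) -> (forall b, C b -> c <= ev b N <= c + e) ->
    exists2 L : seq T, (forall y, y \in L -> B y) & forall b, C b -> exists2 y, y \in L &
      forall i, (i < N.+1)%N -> `|ev b i - ev y i| <= e.
  move=> CB Cc; have [b i /CB/B1//|L LC Lnet] := IHN C.
  exists L => [y /LC/CB//|b Cb]; have [y yL yN] := Lnet b Cb.
  exists y => // i; rewrite ltnS leq_eqVlt => /predU1P[->|]; last exact: yN.
  by have := Cc b Cb; have := Cc y (LC y yL); rewrite ler_norml; lra.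
have net m : exists2 L : seq T, (forall y, y \in L -> B y) &
    forall b, B b -> ev b N <= -1 + m%:R * e -> exists2 y, y \in L &
      forall i, (i < N.+1)%N -> `|ev b i - ev y i| <= e.
  elim: m => [|m [L LB Lnet]].
    have [b []//|b [Bb hb]|L LB Lnet] :=
        netS [set b | B b /\ ev b N <= -1 + 0%:R * e] (-1).
      by have := B1 b N Bb; rewrite ler_norml; lra.
    by exists L => // b Bb hb; exact: Lnet.
  have [b []//|b [Bb /andP[h1 h2]]|L' LB' Lnet'] :=
      netS [set b | B b /\ -1 + m%:R * e <= ev b N <= -1 + m.+1%:R * e] (-1 + m%:R * e).
    by rewrite h1; move: h2; rewrite -natr1; lra.
  exists (L ++ L') => [y|b Bb hb]; first by rewrite mem_cat => /orP[/LB|/LB'].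
  have [h|h] := leP (ev b N) (-1 + m%:R * e).
    by have [y yL yN] := Lnet b Bb h; exists y; rewrite // mem_cat yL.
  have [|y yL yN] := Lnet' b; first by split=> //; rewrite (ltW h).
  by exists y; rewrite // mem_cat yL orbT.
have [L LB Lnet] := net (Num.bound (2 / e)).
exists L => // b Bb; apply: Lnet => //.
have /ltW : 2 / e < (Num.bound (2 / e))%:R by apply: archi_boundP; rewrite divr_ge0// ltW.
by rewrite ler_pdivrMr//; have := B1 b N Bb; rewrite ler_norml; lra.
Qed.

Section lindenstrauss_smooth.
Variables (R : realType) (X : completeNormedModType R) (x : dense_sphere_seq X).
Local Notation Z := (lindenstrauss x).
Implicit Types (z u w : Z) (n N : nat) (l : seq nat) (e tau : R).

Definition loop_ball : set Z :=
  [set z | forall t l, path leq t l -> loop (psum x z) t l <= 1].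

Lemma loop_ball0 : loop_ball 0.
Proof.
move=> t l _; have -> : psum x (0 : Z) = fun n => 0 *: (0 : X).
  by apply/funext => n; rewrite scale0r /psum /series/= big1// => i _; rewrite scale0r.
by rewrite (loopZ 0 (fun=> 0)) expr0n mul0r.
Qed.

Lemma loop_ball_norm z : loop_ball z -> `|z| <= 1.
Proof.
move=> zA; apply: lind_norm_le => // l pl; rewrite expr1n (le_trans _ (zA 0%N l pl))//.
by rewrite /loop psum0 normr0; have := sqr_ge0 `|psum x z (last 0%N l)|; lra.
Qed.

Lemma loop_le_norm z (t : nat) l : path leq t l -> loop (psum x z) t l <= 4 * `|z| ^+ 2.
Proof.
move=> pl; have := walk_le_norm z (l := t :: l) pl.
rewrite /= psum0 subr0 /loop.
have : `|psum x z (last t l)| ^+ 2 <= `|z| ^+ 2 by rewrite ler_pXn2r ?nnegrE// psum_le_norm.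
have := walk_ge0 (psum x z) t l.
lra.
Qed.

Lemma norm_loop_ball z : `|z| <= 1 / 2 -> loop_ball z.
Proof.
move=> z2 t l pl; rewrite (le_trans (loop_le_norm z pl))//.
have : `|z| ^+ 2 <= (1 / 2) ^+ 2 by rewrite ler_pXn2r ?nnegrE.
by rewrite expr2 [(1 / 2) ^+ 2]expr2; lra.
Qed.

(** After a time at which [u] is almost back at the origin, a loop can be inserted at
    the cost of its own energy. *)
Lemma loop_ball_smooth u (t : R) : loop_ball u -> 0 < t -> t <= 1 ->
  exists N, forall z, loop_ball z -> (forall i, (i < N)%N -> z i = 0) ->
    forall tau, `|tau| <= t -> loop_ball ((1 + 2 * t ^+ 2)^-1 *: (u + tau *: z)).
Proof.
(* [u + tau z] is the sum of the concatenation [s] and of the late part [r] of [u]; by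
   [loopD] with parameter [t ^ 2 / 4], an energy of [r] of at most [6 e = t ^ 4 / 10] adds at
   most [t ^ 2 / 2] to the energy [(1 + t ^ 2 / 4) (1 + t ^ 2)] due to [s] *)
move=> uA t0 t1; pose e := t ^+ 4 / 60.
have e0 : 0 < e by rewrite divr_gt0// exprn_gt0.
have [N1 hN1] := walk_tail e0 (fun l pl => walk_le_norm u pl).
have se : 0 < Num.sqrt e by rewrite sqrtr_gt0.
have /cvgrPdist_le/(_ _ se)[N2 _ hN2] := lind_cvg0 u.
exists (maxn N1 N2) => z zA z0 tau taut n l pl.
set N := maxn N1 N2 in z0 *; set c := (1 + 2 * t ^+ 2)^-1.
have t20 : 0 < t ^+ 2 by rewrite exprn_gt0.
have c1 : c * (1 + 2 * t ^+ 2) = 1 by rewrite mulVf// gt_eqF//; lra.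
have c0 : 0 <= c by rewrite invr_ge0; lra.
pose r n := if (n < N)%N then 0 else psum x u n.
pose s n := if (n < N)%N then psum x u n else tau *: psum x z n.
have z0E m : (m <= N)%N -> psum x z m = 0.
  move=> mN; rewrite /psum /series/= big_nat big1// => i /andP[_ im].
  by rewrite z0 ?scale0r// (leq_trans im).
have -> : psum x (c *: (u + tau *: z)) = fun n => c *: (s n + r n).
  apply/funext => m; rewrite -[RHS]/(c *: (s m + r m)).
  have -> : psum x (c *: (u + tau *: z)) m = c *: (psum x u m + tau *: psum x z m).
    by rewrite -psumZ -psumD -psumZ.
  congr (_ *: _); rewrite /s /r; case: ltnP => mN; last by rewrite addrC.
  by rewrite z0E ?scaler0// ltnW.
rewrite (loopZ c (fun n => s n + r n)).
have sl : loop s n l <= 1 + t ^+ 2.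
  apply: (loop_concat (N := N) (u := psum x u) (w := fun n => tau *: psum x z n)) pl.
  - by move=> m mN; rewrite /s mN.
  - by move=> m Nm; rewrite /s ltnNge Nm.
  - exact: uA.
  - move=> m k pk; rewrite loopZ; have := zA m k pk.
    have : tau ^+ 2 <= t ^+ 2.
      by rewrite -[tau ^+ 2]real_normK ?num_real// ler_pXn2r ?nnegrE// ltW.
    by have := sqr_ge0 tau; have := loop_ge0 (psum x z) m k; nra.
have rl : loop r n l <= 6 * e.
  apply: loop_late pl.
    move=> m Nm; have := hN2 m (leq_trans (leq_maxr _ _) Nm).
    rewrite sub0r normrN -(ler_pXn2r (n := 2)) ?nnegrE ?sqrtr_ge0//.
    by rewrite sqr_sqrtr// ltW.
  by move=> m k Nm; apply: hN1; rewrite (leq_trans (leq_maxl _ _) Nm).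
have k0 : 0 < t ^+ 2 / 4 by rewrite divr_gt0.
have := loopD s r n l k0; set L := loop _ _ _ => hL.
have {}hL : L <= 1 + 2 * t ^+ 2.
  have kV : (t ^+ 2 / 4)^-1 * (6 * e) = 2 / 5 * t ^+ 2.
    by rewrite /e; field; rewrite gt_eqF.
  have h1 : (1 + t ^+ 2 / 4) * loop s n l <= (1 + t ^+ 2 / 4) * (1 + t ^+ 2).
    by rewrite ler_wpM2l//; lra.
  have h2 : (1 + (t ^+ 2 / 4)^-1) * loop r n l <= (1 + (t ^+ 2 / 4)^-1) * (6 * e).
    by rewrite ler_wpM2l// addr_ge0// invr_ge0 ltW.
  have t41 : t ^+ 2 * t ^+ 2 <= t ^+ 2 by rewrite ler_piMr ?(ltW t20)// exprn_ile1 ?(ltW t0).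
  have eE : 6 * e = t ^+ 2 * t ^+ 2 / 10 by rewrite /e; field.
  rewrite [leRHS]mulrDl mul1r kV eE in h2.
  have h3 : (1 + t ^+ 2 / 4) * (1 + t ^+ 2) = 1 + 5 / 4 * t ^+ 2 + t ^+ 2 * t ^+ 2 / 4.
    by field.
  rewrite h3 in h1; lra.
have cL : c * L <= 1 by rewrite -c1 ler_wpM2l.
have c11 : c <= 1 by rewrite -c1 ler_peMr//; lra.
rewrite expr2 -mulrA (@le_trans _ _ (c * 1))//; last by rewrite mulr1.
by rewrite ler_wpM2l.
Qed.

(** Subtracting from a vector a lift of its head leaves a vector with zero head.  The heads
    of the unit ball have a finite net, so that finitely many lifts have to be tested to
    make this subtraction harmless for [h]. *)
Lemma dual_norm_zero_head N e : 0 < e ->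
  exists vs : seq Z, exists2 d : R, 0 < d & forall h : dual Z,
    e <= `|h| -> (forall v, v \in vs -> `|h v| <= d) ->
    exists z, [/\ loop_ball z, (forall i, (i < N)%N -> z i = 0) & 48^-1 * e <= h z].
Proof.
move=> e0.
(* [h] is at least [3/4 |h|] at some [z] of norm at most 1, and [w = z - f y - q] has zero
   head; the lift [f y] of the head of the net is weak* tested, and the correction [q] has
   norm at most [4 N eta <= 1/4], so that [h w >= |h| / 4]; as [|w| <= 6], the vector
   [w / 12] is in [loop_ball] *)
pose eta : R := (16 * N.+1%:R)^-1.
have eta0 : 0 < eta by rewrite invr_gt0 mulr_gt0.
have etaN : 16 * (N%:R * eta) <= 1.
  have : 16 * (N.+1%:R * eta) = 1.
    by rewrite mulrA mulfV// mulf_neq0// pnatr_eq0.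
  by rewrite -natr1 mulrDl mul1r; lra.
have [L LB Lnet] := @finite_net R Z (fun z i => z i) eta N [set z : Z | `|z| <= 1] eta0
  (fun b i b1 => le_trans (coord_le_norm b i) b1).
have /choice[f fP] (y : Z) : exists v : Z, `|y| <= 1 ->
    (forall i, (i < N)%N -> v i = y i) /\ `|v| <= 4.
  have [y1|y1] := leP `|y| 1; last by exists 0.
  have [l pl|v vy v4] := @head_lift _ _ x y N 1 ler01.
    by rewrite (le_trans (walk_le_norm y pl))// ler_pXn2r ?nnegrE.
  by exists v; rewrite -[4]mulr1.
exists (map f L), (e / 4); first by rewrite divr_gt0.
move=> h he hvs.
have h0 : 0 < `|h| by rewrite (lt_le_trans e0).
have [||z z1 hz] := @dual_norm_attained _ _ h (3 / 4 * `|h|); [lra|lra|].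
have [y yL yz] := Lnet z z1; have [fy f4] := fP y (LB y yL).
have Neta : 0 <= N%:R * eta by rewrite mulr_ge0// ltW.
have [|q qa qN] := @head_lift _ _ x (head (fun i => z i - y i) N) N (N%:R * eta) Neta.
  by apply: walk_head; [exact: ltW|exact: yz].
pose w := z - f y - q.
exists (12^-1 *: w); split.
- apply: norm_loop_ball; rewrite normrZ gtr0_norm ?invr_gt0//.
  have : `|w| <= `|z| + `|f y| + `|q|.
    rewrite /w (le_trans (ler_normB _ _))// lerD2r.
    exact: ler_normB.
  lra.
- move=> i iN; rewrite -[LHS]/(12^-1 * (z i - f y i - q i)).
  by rewrite fy// qa// /head iN; lra.
have hw : h w = h z - h (f y) - h q by rewrite /w !linearB.
rewrite dual_evalZ hw.
have := hvs (f y) (map_f f yL); rewrite ler_norml => /andP[_ h1].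
have : h q <= `|h| * (4 * (N%:R * eta)).
  by rewrite (le_trans (ler_norm _))// (le_trans (ler_dual_norm h q))// ler_wpM2l.
have : `|h| * (16 * (N%:R * eta)) <= `|h| by rewrite ler_piMr// ltW.
lra.
Qed.

Lemma szlenk_upper_lindenstrauss e : 0 < e ->
  exists n, szlenk_derived e [set f : dual Z | `|f| <= 1] (ord_nat n) = set0.
Proof.
apply: (@szlenk_upper _ _ loop_ball 48^-1) => //.
- exact: loop_ball0.
- exact: loop_ball_norm.
move=> u t d uA t0 t1 d0; have [N hN] := loop_ball_smooth uA t0 t1.
have [vs [r r0 hr]] := dual_norm_zero_head N d0; exists vs, r => // h dh hvs.
by have [z [zA zN hz]] := hr h dh hvs; exists z => //; exact: hN.
Qed.

(** Otherwise the supremum of [f] over [loop_ball] could be exceeded by adding to an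
    almost maximizing vector a small multiple of one with zero head: the value of [f]
    would grow linearly, but the gauge only quadratically. *)
Lemma dual_zero_head_small (f : dual Z) e : 0 < e ->
  exists N, forall z, (forall i, (i < N)%N -> z i = 0) -> `|f z| <= e * `|z|.
Proof.
move=> e0; pose E := [set f u | u in loop_ball] : set R.
have Eub : ubound E `|f|.
  move=> _ [u uA <-]; rewrite (le_trans (ler_norm _))// (le_trans (ler_dual_norm f u))//.
  by rewrite ler_piMr// loop_ball_norm.
have Esup : has_sup E.
  by split; [exists (f 0), 0 => //; exact: loop_ball0|exists `|f|].
pose g := sup E.
have gf : g <= `|f| by apply: ge_sup => //; case: Esup.
pose t := Num.min 1 (e / (8 * (`|f| + 1))).
have f10 : 0 < 8 * (`|f| + 1) by rewrite mulr_gt0// ltr_wpDl.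
have t0 : 0 < t by rewrite lt_min ltr01 divr_gt0.
have t1 : t <= 1 by rewrite ge_min lexx.
have tf : t * (8 * (`|f| + 1)) <= e by rewrite -ler_pdivlMr// ge_min lexx orbT.
have d0 : 0 < t * e / 4 by rewrite divr_gt0// mulr_gt0.
have [_ [u uA <-] ug] := sup_adherent d0 Esup.
have [N hN] := loop_ball_smooth uA t0 t1.
have H z : (forall i, (i < N)%N -> z i = 0) -> f z <= e * `|z|.
  move=> z0; have [->|zn0] := eqVneq z 0; first by rewrite linear0 normr0 mulr0.
  have zn : 0 < `|z| by rewrite normr_gt0.
  rewrite leNgt; apply/negP => fz; pose w : Z := (2 * `|z|)^-1 *: z.
  have wA : loop_ball w.
    apply: norm_loop_ball; rewrite normrZ ger0_norm ?invr_ge0 ?mulr_ge0//.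
    by rewrite invfM -mulrA mulVf ?gt_eqF// mulr1 mul1r.
  have w0 i : (i < N)%N -> w i = 0.
    by move=> /z0 zi; rewrite -[LHS]/((2 * `|z|)^-1 * z i) zi mulr0.
  have fw : e / 2 < f w.
    rewrite dual_evalZ ltr_pdivlMl ?mulr_gt0//.
    by rewrite mulrAC -mulrA mulrC; lra.
  have tt : `|t| <= t by rewrite gtr0_norm.
  have : f ((1 + 2 * t ^+ 2)^-1 *: (u + t *: w)) <= g.
    by apply: ub_le_sup; [case: Esup|exists ((1 + 2 * t ^+ 2)^-1 *: (u + t *: w)) => //; exact: hN].
  have t20 : 0 < t ^+ 2 by rewrite exprn_gt0.
  rewrite dual_evalZ linearD/= dual_evalZ.
  rewrite ler_pdivrMl; last by lra.
  move=> h.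
  have h1 : t * (e / 2) < t * f w by rewrite ltr_pM2l.
  have h2 : t ^+ 2 * g <= t ^+ 2 * `|f| by rewrite ler_wpM2l// ltW.
  have h3 : t * (t * (8 * (`|f| + 1))) <= t * e by rewrite ler_wpM2l// ltW.
  rewrite -/g in ug; nra.
exists N => z z0; rewrite ler_norml H// andbT lerNl.
rewrite -[leLHS](linearN f) -(normrN z) H// => i iN.
by rewrite -[LHS]/(- z i) z0// oppr0.
Qed.

End lindenstrauss_smooth.

Lemma bidual_ev (R : realType) (V : normedModType R) (v : V) :
  exists E : dual (dual V), forall f, E f = f v.
Proof.
apply: (@dual_build _ _ (fun f : dual V => f v) `|v|) => [//|f].
by rewrite mulrC ler_dual_norm.
Qed.

(** * Coordinate functionals *)

Section lindenstrauss_dual.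
Variables (R : realType) (X : completeNormedModType R) (x : dense_sphere_seq X).
Local Notation Z := (lindenstrauss x).
Implicit Types (z u w : Z) (f g : dual Z) (h : dual (dual Z)) (i n N t : nat).
Implicit Types (s : nat -> X) (l : seq nat) (m : seq (nat * dual X)) (c e : R).

Lemma coord_exists i : exists f : dual Z, forall z, f z = z i.
Proof.
apply: (@dual_build _ _ (fun z : Z => z i) 1) => [//|z].
by rewrite mul1r coord_le_norm.
Qed.

Definition coord i : dual Z := sval (cid (coord_exists i)).

Lemma coordE i z : coord i z = z i.
Proof. exact: (svalP (cid (coord_exists i))). Qed.

Lemma unit_heads N : exists u : nat -> Z,
  forall i j, (j < N)%N -> u i j = (j == i)%:R.
Proof.
suff /choice[u uE] : forall i, exists v : Z, forall j, (j < N)%N -> v j = (j == i)%:R.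
  by exists u.
move=> i; have [|z zi _] := @head_lift _ _ x (fun j => (j == i)%:R) N 1 ler01; last by exists z.
apply: walk_l1 => n; elim: n => [|n IHn]; first by rewrite big_ord0.
rewrite big_ord_recr/=; case: eqP => [ni|_]; last by rewrite normr0 addr0.
rewrite big1 ?normr1 ?add0r// => j _.
by rewrite -ni ltn_eqF// normr0.
Qed.

Lemma lind_sum_coord (u : nat -> Z) (c : nat -> R) N j :
  (\sum_(i < N) c i *: u i) j = \sum_(i < N) c i * u i j.
Proof.
rewrite -coordE linear_sum; apply: eq_bigr => i _ /=.
by rewrite dual_evalZ coordE.
Qed.

Lemma dual_zero_head_span f N : (forall z, (forall i, (i < N)%N -> z i = 0) -> f z = 0) ->
  exists c : nat -> R, f = \sum_(i < N) c i *: coord i.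
Proof.
move=> f0; have [u uE] := unit_heads N; exists (fun i => f (u i)); apply: dual_ext => z.
have [E EE] := bidual_ev z; rewrite -(EE (\sum_(i < N) _)) linear_sum.
have -> : f z = f (\sum_(i < N) z i *: u i).
  apply/eqP; rewrite -subr_eq0 -[_ - _]linearB/= f0// => j jN.
  rewrite -[LHS]/(z j - (\sum_(i < N) z i *: u i) j) lind_sum_coord.
  rewrite (bigD1 (Ordinal jN))//= uE// eqxx mulr1 big1 ?addr0 ?subrr// => i ij.
  by rewrite uE// eq_sym (negbTE (_ : (i != j :> nat))) ?mulr0.
rewrite linear_sum; apply: eq_bigr => i _ /=.
by rewrite !dual_evalZ EE coordE mulrC.
Qed.

(** By [dual_zero_head_small] and the Hahn-Banach theorem, a functional differs by one of
    small norm from a combination of the first [N] coordinates.  On such combinations,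
    [h] acts as the vector obtained by lifting its first [N] coordinates. *)
Lemma bidual_norm_le h c : 0 <= c ->
  (forall l, path leq 0%N l -> walk (psum x (fun i => h (coord i))) 0 l <= c ^+ 2) ->
  `|h| <= 4 * c.
Proof.
move=> c0 hc; set a := fun i => h (coord i) in hc.
apply/ler_dualP; first by rewrite mulr_ge0.
move=> f; apply/ler_addgt0Pr => e e0.
pose d := e / (`|h| + 4 * c + 1).
have D0 : 0 < `|h| + 4 * c + 1 by rewrite ltr_wpDl// addr_ge0// mulr_ge0.
have d0 : 0 < d by rewrite divr_gt0.
have [N hN] := dual_zero_head_small f d0.
have [|b u v u0 v0 i iN||g gd gf] :=
    @dual_extension _ _ [set z : Z | forall i, (i < N)%N -> z i = 0] f d (ltW d0).
- by [].
- by rewrite -[LHS]/(b * u i + v i) u0// v0// mulr0 addr0.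
- by move=> v; exact: hN.
have [|b fgb] := @dual_zero_head_span (f - g) N.
  by move=> z z0; rewrite dualBE gf// subrr.
have [z za z4] := head_lift N c0 hc.
have hfg : h (f - g) = (f - g) z.
  rewrite fgb linear_sum; have [E EE] := bidual_ev z.
  rewrite -(EE (\sum_(i < N) _)) linear_sum; apply: eq_bigr => i _ /=.
  by rewrite !dual_evalZ EE coordE za.
have -> : h f = (f - g) z + h g by rewrite -hfg linearB subrK.
rewrite (le_trans (ler_normD _ _))//.
have h1 : `|(f - g) z| <= (`|f| + d) * (4 * c).
  rewrite (le_trans (ler_dual_norm _ _))// ler_pM// (le_trans (ler_normB _ _))//.
  by rewrite lerD2l.
have h2 : `|h g| <= `|h| * d by rewrite (le_trans (ler_dual_norm _ _))// ler_wpM2l.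
have : d * (`|h| + 4 * c + 1) = e by rewrite divfK// gt_eqF.
lra.
Qed.

(** * Asymptotic smoothness of the dual *)

(** Expanded in coordinates so that elements of the bidual can be applied to it; on a
    vector it is the pairing of the list with the path of that vector. *)
Fixpoint block_functional t m : dual Z :=
  if m is (t', y) :: m' then
    \sum_(t <= i < t') y (x i) *: coord i + block_functional t' m'
  else 0.

Fixpoint pairing s t m : R :=
  if m is (t', y) :: m' then y (s t' - s t) + pairing s t' m' else 0.

Definition sqsum m : R := \sum_(p <- m) `|p.2| ^+ 2.

Lemma sqsum_cons p m : sqsum (p :: m) = `|p.2| ^+ 2 + sqsum m.
Proof. by rewrite /sqsum big_cons. Qed.

Lemma bidual_block_functional h t m : path leq t (unzip1 m) ->
  h (block_functional t m) = pairing (psum x (fun i => h (coord i))) t m.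
Proof.
elim: m t => [|[t' y] m IHm] t /=; first by rewrite linear0.
move=> /andP[tt' pm]; rewrite linearD/= IHm//; congr (_ + _).
rewrite -psum_block// !linear_sum; apply: eq_bigr => i _ /=.
by rewrite !dual_evalZ mulrC.
Qed.

Lemma block_functionalE z t m : path leq t (unzip1 m) ->
  block_functional t m z = pairing (psum x z) t m.
Proof.
move=> pm; have [E EE] := bidual_ev z; rewrite -EE bidual_block_functional//.
by congr pairing; apply/funext => n; apply: eq_psum => i _; rewrite EE coordE.
Qed.

Lemma block_functional_cat t m m' : block_functional t (m ++ m') =
  block_functional t m + block_functional (last t (unzip1 m)) m'.
Proof.
by elim: m t => [|[t' y] m IHm] t /=; rewrite ?add0r// IHm addrA.
Qed.

Definition scale_list c m := [seq (p.1, c *: p.2) | p <- m].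

Lemma unzip1_scale c m : unzip1 (scale_list c m) = unzip1 m.
Proof. by rewrite /unzip1 -map_comp. Qed.

Lemma sqsum_scale c m : sqsum (scale_list c m) = c ^+ 2 * sqsum m.
Proof.
rewrite /sqsum big_map mulr_sumr; apply: eq_bigr => p _ /=.
by rewrite normrZ exprMn real_normK ?num_real.
Qed.

Lemma block_functional_scale c t m :
  block_functional t (scale_list c m) = c *: block_functional t m.
Proof.
elim: m t => [|[t' y] m IHm] t /=; first by rewrite scaler0.
rewrite IHm scalerDr scaler_sumr; congr (_ + _); apply: eq_bigr => i _.
by rewrite scalerA.
Qed.

Lemma pairing_le s t m c : 0 < c ->
  pairing s t m <= (c * sqsum m + c^-1 * walk s t (unzip1 m)) / 2.
Proof.
move=> c0; elim: m t => [|[t' y] m IHm] t /=.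
  by rewrite /sqsum big_nil !mulr0 addr0 mul0r.
rewrite sqsum_cons/=; have := IHm t'; set D := s t' - s t.
have yD : y D <= `|y| * `|D| by rewrite (le_trans (ler_norm _))// ler_dual_norm.
have cV : c * c^-1 = 1 by rewrite divff// gt_eqF.
have := mulr_ge0 (ltW c0) (sqr_ge0 (`|y| - c^-1 * `|D|)).
have -> : c * (`|y| - c^-1 * `|D|) ^+ 2 =
  c * `|y| ^+ 2 - 2 * (c * c^-1) * (`|y| * `|D|) + (c * c^-1) * c^-1 * `|D| ^+ 2 by ring.
by rewrite cV; lra.
Qed.

(** This is the equality case of the Cauchy-Schwarz inequality: each jump is paired with a
    multiple of a functional that norms it. *)
Lemma pairing_walk s t l c : 0 <= c ->
  exists m, [/\ unzip1 m = l, sqsum m <= c ^+ 2 * walk s t l & pairing s t m = c * walk s t l].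
Proof.
move=> c0; elim: l t => [|t' l IHl] t.
  by exists [::]; rewrite /sqsum big_nil /= !mulr0.
have [m [ml ms mp]] := IHl t'; have [g g1 gD] := norming_functional (s t' - s t).
exists ((t', (c * `|s t' - s t|) *: g) :: m); split=> /=; first by rewrite ml.
  rewrite sqsum_cons/= mulrDr lerD// -exprMn ler_pXn2r ?nnegrE ?mulr_ge0//.
  by rewrite normrZ ger0_norm ?mulr_ge0// ler_piMr// mulr_ge0.
by rewrite mp -[X in X + _]/(c * `|s t' - s t| * g (s t' - s t)) gD mulrDr expr2 mulrA.
Qed.

Definition block_ball : set (dual Z) :=
  [set f | exists m, [/\ path leq 0%N (unzip1 m), sqsum m <= 1 & f = block_functional 0 m]].

Lemma block_ball0 : block_ball 0.
Proof. by exists [::]; rewrite /sqsum big_nil. Qed.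

Lemma block_ball_norm f : block_ball f -> `|f| <= 1.
Proof.
move=> [m [pm m1 ->]].
have H z : block_functional 0 m z <= `|z|.
  have [->|z0] := eqVneq z 0; first by rewrite linear0 normr0.
  have zn : 0 < `|z| by rewrite normr_gt0.
  rewrite block_functionalE// (le_trans (pairing_le _ _ _ zn))//.
  have h1 : `|z| * sqsum m <= `|z| by rewrite ler_piMr.
  have h2 : `|z|^-1 * walk (psum x z) 0 (unzip1 m) <= `|z|.
    by rewrite ler_pdivrMl// -expr2 walk_le_norm.
  lra.
apply/ler_dualP => // z; rewrite mul1r ler_norml H andbT lerNl.
by rewrite -[leLHS]linearN -(normrN z) H.
Qed.

Lemma bidual_walk_ge h e : 0 < e -> e <= `|h| -> exists2 l, path leq 0%N l &
  (e / 5) ^+ 2 < walk (psum x (fun i => h (coord i))) 0 l.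
Proof.
move=> e0 eh; apply: contrapT => nl.
have e5 : 0 <= e / 5 by rewrite divr_ge0// ltW.
suff /(bidual_norm_le e5) : forall l, path leq 0%N l ->
    walk (psum x (fun i => h (coord i))) 0 l <= (e / 5) ^+ 2 by lra.
by move=> l pl; rewrite leNgt; apply/negP => hl; apply: nl; exists l.
Qed.

(** The path of [h] splits into the path stopped at time [N] and the path started at
    time [N].  If the first [N] coordinates of [h] are small then so is the variation of
    the stopped path, and most of the norm of [h] comes from walks after time [N]. *)
Lemma bidual_norm_tail N e : 0 < e ->
  exists vs : seq (dual Z), exists2 d : R, 0 < d & forall h,
    e <= `|h| -> (forall v, v \in vs -> `|h v| <= d) ->
    exists m, [/\ path leq N (unzip1 m), sqsum m <= 1 &
      10^-1 * e <= h (block_functional N m)].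
Proof.
move=> e0; exists [seq coord i | i <- iota 0 N], (e / (10 * N.+1%:R)).
  by rewrite divr_gt0// mulr_gt0.
set d := e / _ => h eh hd; have [l pl hl] := bidual_walk_ge e0 eh.
set a := fun i => h (coord i) in hl.
have dN : N%:R * d <= e / 10.
  have : N.+1%:R * d = e / 10 by rewrite /d; field; rewrite addrC natr1 pnatr_eq0.
  have d0 : 0 < d by rewrite divr_gt0// mulr_gt0.
  by rewrite -natr1 mulrDl mul1r; lra.
have split_walk : walk (psum x a) 0 l <=
    2 * walk (psum x a \o minn^~ N) 0 l + 2 * walk (psum x a \o maxn^~ N) 0 l.
  have -> : walk (psum x a) 0 l = walk (fun n => (psum x a \o minn^~ N) n +
      (psum x a \o maxn^~ N) n) 0 l.
    have H t l' : walk (psum x a) t l' = walk (fun n => (psum x a \o minn^~ N) n +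
        (psum x a \o maxn^~ N) n) t l'.
      elim: l' t => [//|t' l' IHl'] t /=; rewrite IHl'; congr (`|_| ^+ 2 + _).
      have E k : psum x a (minn k N) + psum x a (maxn k N) = psum x a k + psum x a N.
        by rewrite /minn /maxn; case: ifP => // _; rewrite addrC.
      by rewrite !E opprD addrACA subrr addr0.
    exact: H.
  by have := walkD (psum x a \o minn^~ N) (psum x a \o maxn^~ N) 0 l ltr01; rewrite invr1.
have head_walk : walk (psum x a \o minn^~ N) 0 l <= (e / 10) ^+ 2.
  have d0 : 0 <= d by rewrite divr_ge0 ?ltW// mulr_gt0.
  have ad i : (i < N)%N -> `|a i| <= d.
    by move=> iN; apply: hd; apply: map_f; rewrite mem_iota.
  rewrite -psum_head (le_trans (walk_head x d0 ad pl))//.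
  by rewrite ler_pXn2r ?nnegrE ?mulr_ge0// ltW.
pose k := [seq maxn i N | i <- l].
have pk : path leq N k.
  rewrite -[N in path _ N](max0n N); apply: (path_leq_map (f := maxn^~ N)) pl.
  by move=> i j ij; rewrite geq_max leq_maxr andbT (leq_trans ij)// leq_maxl.
pose W := walk (psum x a) N k.
have hW : (e / 10) ^+ 2 <= W.
  have : walk (psum x a \o maxn^~ N) 0 l = W by rewrite walk_comp max0n.
  have : (e / 10) ^+ 2 = (e / 5) ^+ 2 / 4 by field.
  lra.
have W0 : 0 < W by rewrite (lt_le_trans _ hW)// exprn_gt0// divr_gt0.
have sW0 : 0 < Num.sqrt W by rewrite sqrtr_gt0.
have sW : Num.sqrt W ^+ 2 = W by rewrite sqr_sqrtr// ltW.
have sV0 : 0 <= (Num.sqrt W)^-1 by rewrite invr_ge0 ltW.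
have [m [mk ms mp]] := pairing_walk (psum x a) N k sV0.
exists m; split; first by rewrite mk.
  by rewrite (le_trans ms)// -/W -{2}sW exprVn mulVf// expf_neq0// gt_eqF.
rewrite bidual_block_functional ?mk// mp -/W -{2}sW expr2 mulKf ?gt_eqF//.
rewrite -(ler_pXn2r (n := 2)) ?nnegrE ?(ltW sW0)//; last by rewrite mulr_ge0 ?invr_ge0// ltW.
by rewrite sW mulrC.
Qed.

Lemma szlenk_upper_lindenstrauss_dual e : 0 < e ->
  exists n, szlenk_derived e [set h : dual (dual Z) | `|h| <= 1] (ord_nat n) = set0.
Proof.
apply: (@szlenk_upper _ _ block_ball 10^-1) => //.
- exact: block_ball0.
- exact: block_ball_norm.
move=> _ t d [l [pl l1 ->]] t0 t1 d0.
have [vs [r r0 hr]] := bidual_norm_tail (last 0%N (unzip1 l)) d0.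
exists vs, r => // h dh hvs; have [m [pm m1 hm]] := hr h dh hvs.
exists (block_functional (last 0%N (unzip1 l)) m) => // tau taut.
set c := (1 + _)^-1; exists (scale_list c (l ++ scale_list tau m)); split.
- by rewrite unzip1_scale /unzip1 map_cat cat_path -!/(unzip1 _) unzip1_scale pl.
- rewrite sqsum_scale /sqsum big_cat/= -/(sqsum _) -/(sqsum _) sqsum_scale.
  have tt : tau ^+ 2 <= t ^+ 2.
    by rewrite -[tau ^+ 2]real_normK ?num_real// ler_pXn2r ?nnegrE// ltW.
  have t20 : 0 < t ^+ 2 by rewrite exprn_gt0.
  have c1 : c * (1 + 2 * t ^+ 2) = 1 by rewrite mulVf// gt_eqF//; lra.
  have c0 : 0 <= c by rewrite invr_ge0; lra.
  have c11 : c <= 1 by rewrite -c1 ler_peMr//; lra.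
  have h1 : tau ^+ 2 * sqsum m <= t ^+ 2.
    by rewrite (le_trans _ tt)// ler_piMr// sqr_ge0.
  have h2 : c * (sqsum l + tau ^+ 2 * sqsum m) <= 1.
    by rewrite -c1 ler_wpM2l//; lra.
  by rewrite expr2 -mulrA (le_trans _ c11)// ler_piMr.
- by rewrite block_functional_scale block_functional_cat block_functional_scale.
Qed.

(** * Infinite dimension *)

Lemma nontrivial_combination n (F : 'I_n -> nat -> R) :
  exists c : nat -> R, (exists2 i, (i < n.+1)%N & c i != 0) /\
    forall j, \sum_(i < n.+1) c i * F j i = 0.
Proof.
pose A : 'M[R]_(n.+1, n) := \matrix_(i, j) F j i.
have [v vA v0] : exists2 v : 'rV[R]_n.+1, v *m A = 0 & v != 0.
  have : kermx A != 0.
    rewrite kermx_eq0 /row_free; apply/negP => /eqP rA.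
    by have := rank_leq_col A; rewrite rA ltnn.
  by move=> /rowV0Pn[v /sub_kermxP vA v0]; exists v.
exists (fun i => v ord0 (inord i)); split.
  have /existsP[i vi] : [exists i, v ord0 i != 0].
    apply: contraNT v0 => /existsPn v0; apply/eqP/rowP => i; rewrite mxE.
    by apply/eqP; rewrite -[_ == _]negbK v0.
  by exists i; rewrite // inord_val.
move=> j; have /rowP/(_ j) := vA; rewrite !mxE => vj.
by rewrite -[RHS]vj; apply: eq_bigr => i _; rewrite mxE inord_val.
Qed.

Lemma lindenstrauss_annihilator (vs : seq Z) :
  exists2 g : dual Z, g != 0 & forall v, v \in vs -> g v = 0.
Proof.
have [c [[k kn ck] cF]] := @nontrivial_combination (size vs) (fun j i => vs`_j i).
have gE z : (\sum_(i < (size vs).+1) c i *: coord i) z = \sum_(i < (size vs).+1) c i * z i.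
  have [E EE] := bidual_ev z; rewrite -EE linear_sum; apply: eq_bigr => i _ /=.
  by rewrite dual_evalZ EE coordE.
exists (\sum_(i < (size vs).+1) c i *: coord i).
  have [u uE] := unit_heads (size vs).+1; apply/eqP => g0.
  move/negP : ck; apply; apply/eqP; have := gE (u k); rewrite g0 dual0E.
  rewrite (bigD1 (Ordinal kn))//= uE// eqxx mulr1 big1 ?addr0// => i ik.
  by rewrite uE// (negbTE (_ : (i != k :> nat))) ?mulr0.
move=> v /(nthP 0)[j jn <-]; rewrite gE; exact: (cF (Ordinal jn)).
Qed.

Lemma lindenstrauss_preannihilator (fs : seq (dual Z)) :
  exists2 z : Z, z != 0 & forall f, f \in fs -> f z = 0.
Proof.
have [u uE] := unit_heads (size fs).+1.
have [c [[k kn ck] cF]] := @nontrivial_combination (size fs) (fun j i => fs`_j (u i)).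
exists (\sum_(i < (size fs).+1) c i *: u i).
  apply/eqP => z0; move/negP : ck; apply; apply/eqP.
  have := lind_sum_coord u c (size fs).+1 k; rewrite z0.
  rewrite (bigD1 (Ordinal kn))//= uE// eqxx mulr1 big1 ?addr0// => i ik.
  by rewrite uE// eq_sym (negbTE (_ : (i != k :> nat))) ?mulr0.
move=> f /(nthP 0)[j jn <-]; rewrite linear_sum -[RHS](cF (Ordinal jn)).
by apply: eq_bigr => i _ /=; rewrite dual_evalZ.
Qed.

End lindenstrauss_dual.

Theorem theorem1p2 (R : realType) (X : completeNormedModType R)
  (sepX : separable X) (X_neq0 : exists v : X, v != 0)
  (x : dense_sphere_seq X) :
  eord_eq (szlenk (lindenstrauss x)) (Some omega) /\
  eord_eq (szlenk (dual (lindenstrauss x))) (Some omega).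
Proof.
split; apply: szlenk_eq_omega.
- exact: szlenk_upper_lindenstrauss.
- exact/szlenk_lower/lindenstrauss_annihilator.
- exact: szlenk_upper_lindenstrauss_dual.
apply: szlenk_lower => fs; have [z z0 fz] := lindenstrauss_preannihilator fs.
have [E EE] := bidual_ev z; exists E; last by move=> f /fz; rewrite EE.
apply: contra_neq z0 => E0; apply: lind_ext => i.
by rewrite -coordE -EE E0.
Qed.
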